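(* Let $1\le p<n$ and let $\varphi$ be a $C^\infty$ skew-product diffeomorphism of $T^n=T^p\times T^{n-p}$ given on the covering $\mathbb{R}^n=\mathbb{R}^p\times\mathbb{R}^{n-p}$ by $$\varphi(X,Y)=(X+\alpha,\; CX+BY+F(X)),$$ where $\alpha\in\mathbb{R}^p$, $B\in GL(n-p,\mathbb{Z})$, $C$ is an $(n-p)\times p$ integer matrix, and $F:\mathbb{R}^p\to\mathbb{R}^{n-p}$ is $C^\infty$ and $\mathbb{Z}^p$-periodic. Suppose that the linear part of $\varphi$ is quasi-unipotent and that the translation vector $\alpha$ is Diophantine. Then $\varphi$ is smoothly ($C^\infty$) conjugate to its corresponding affine transformation $\varphi_0$ of $T^n$, given on the covering $\mathbb{R}^n$ by $$\varphi_0(X,Y)=(X+\alpha,\; CX+BY+\beta_1).$$ Moreover, if $\varphi$ is minimal, then $1$ is the only eigenvalue of the linear part of $\varphi$.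
   Context: Here $T^k=\mathbb{R}^k/\mathbb{Z}^k$. The vector $\beta_1\in\mathbb{R}^{n-p}$ is $\beta_1=\mathrm{Proj}(\beta)$, where $\beta=\int_{T^p}F\,d\mu$ with $\mu$ the normalized Haar measure of $T^p$, and $\mathrm{Proj}:\mathbb{R}^{n-p}\to\ker (I-B)^t$ is the orthogonal projection onto the kernel of the transpose of $I-B$. The linear part of $\varphi$ is the map induced on $H_1(T^n,\mathbb{Z})\cong\mathbb{Z}^n$, i.e. the matrix $\begin{pmatrix} I & 0\\ C & B\end{pmatrix}$. An integer matrix in $GL(n,\mathbb{Z})$ is quasi-unipotent if all of its eigenvalues are roots of unity. A homeomorphism is minimal if all of its orbits are dense. A vector $\alpha\in\mathbb{R}^p$ is Diophantine if there are constants $r>0$ and $c>0$ such that $\|\langle k,\alpha\rangle\|\ge c|k|^{-r}$ for every $k\in\mathbb{Z}^p\setminus\{0\}$, where $\|x\|=\inf\{|x-m| : m\in\mathbb{Z}\}$ for $x\in\mathbb{R}$. (For $p=1$ this is equivalent to $\alpha$ being an irrational number for which there are $c>0$, $r\ge 0$ with $\|q\alpha\|\ge c|q|^{-1-r}$ for all nonzero $q\in\mathbb{Z}$.) *)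

(* Defs.v *)
From HB Require Import structures.
From mathcomp Require Import all_boot all_order all_algebra.
From mathcomp Require Import complex.
From mathcomp Require Import all_classical all_reals all_analysis.

Set Implicit Arguments.
Unset Strict Implicit.
Unset Printing Implicit Defensive.

Import Order.TTheory GRing.Theory Num.Theory.
Import numFieldNormedType.Exports.

Local Open Scope classical_set_scope.
Local Open Scope ring_scope.
Local Open Scope quotient_scope.

(* Points of R^n are column vectors, so that integer matrices act on the left *)
Definition intmx (R : realType) (m n : nat) (A : 'M[int]_(m, n)) : 'M[R]_(m, n) :=
  map_mx intr A.

Definition Zn_equiv (R : realType) (n : nat) : rel 'cV[R]_n :=
  fun x y => [forall i, (x i 0 - y i 0) \is a Num.int].

Lemma Zn_equiv_equiv (R : realType) (n : nat) :
  equiv_class_of (@Zn_equiv R n).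
Proof.
split=> [x|x y|y x z].
- by apply/forallP => i; rewrite subrr rpred0.
- by apply/forallP/forallP => h i; rewrite -opprB rpredN.
- move=> /forallP xy /forallP yz; apply/forallP => i.
  by rewrite -[x i 0](subrK (y i 0)) -addrA rpredD.
Qed.

Canonical Zn_equiv_rel (R : realType) (n : nat) :=
  EquivRelPack (Zn_equiv_equiv R n).

(* The torus R^n / Z^n with the quotient topology *)
Definition torus (R : realType) (n : nat) :=
  quotient_topology {eq_quot (Zn_equiv_rel R n)}.

HB.instance Definition _ (R : realType) (n : nat) :=
  PointedTopological.on (torus R n).
HB.instance Definition _ (R : realType) (n : nat) :=
  Quotient.on (torus R n).

Definition proj_torus (R : realType) (n : nat) (x : 'cV[R]_n) : torus R n :=
  \pi_(torus R n) x.

Definition borel_torus (R : realType) (n : nat) :=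
  g_sigma_algebraType (@open (torus R n)).

(* In finite dimension, f is of class C^(k+1) iff it has all directional
   derivatives at all points and each of them is of class C^k *)
Fixpoint Ck (R : realType) (U V : normedModType R) (k : nat) (f : U -> V) : Prop :=
  match k with
  | 0 => continuous f
  | k'.+1 => (forall x v, derivable f x v) /\
             (forall v, Ck k' (fun x => 'D_v f x))
  end.

Definition smooth (R : realType) (U V : normedModType R) (f : U -> V) : Prop :=
  forall k, Ck k f.

(* phi is given on the covering by f *)
Definition given_by (R : realType) (m n : nat)
    (phi : torus R m -> torus R n) (f : 'cV[R]_m -> 'cV[R]_n) : Prop :=
  forall x, phi (proj_torus x) = proj_torus (f x).

(* The projections R^n -> T^n are smooth coverings and R^m is simply connected,
   so a map of tori is C^oo iff it has a C^oo lift *)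
Definition torus_smooth (R : realType) (m n : nat)
    (phi : torus R m -> torus R n) : Prop :=
  exists f : 'cV[R]_m -> 'cV[R]_n, smooth f /\ given_by phi f.

Definition torus_diffeo (R : realType) (n : nat)
    (phi : torus R n -> torus R n) : Prop :=
  torus_smooth phi /\
  exists psi, [/\ torus_smooth psi, cancel phi psi & cancel psi phi].

Definition smoothly_conjugate (R : realType) (n : nat)
    (phi psi : torus R n -> torus R n) : Prop :=
  exists h, torus_diffeo h /\ h \o phi = psi \o h.

(* For bijective phi, this is {phi^k x | k in Z} *)
Definition full_orbit (T : Type) (phi : T -> T) (x : T) : set T :=
  [set y | exists k : nat, y = iter k phi x \/ x = iter k phi y].

Definition minimal (T : topologicalType) (phi : T -> T) : Prop :=
  forall x, dense (full_orbit phi x).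

Definition skew_lift (R : realType) (p q : nat) (alpha : 'cV[R]_p)
    (B : 'M[int]_q) (C : 'M[int]_(q, p)) (F : 'cV[R]_p -> 'cV[R]_q)
    (z : 'cV[R]_(p + q)) : 'cV[R]_(p + q) :=
  let X := usubmx z in let Y := dsubmx z in
  col_mx (X + alpha) (intmx R C *m X + intmx R B *m Y + F X).

(* The action on H_1(T^(p+q), Z) = Z^(p+q) of the map given on the covering by
   skew_lift alpha B C F: a lift f satisfies f (z + k) = f z + linear_part B C k
   for every integer vector k *)
Definition linear_part (p q : nat) (B : 'M[int]_q) (C : 'M[int]_(q, p)) :
    'M[int]_(p + q) :=
  block_mx 1%:M 0 C B.

Definition complex_eigenvalue (R : realType) (n : nat) (A : 'M[int]_n) (a : R[i]) :
    bool :=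
  eigenvalue (map_mx intr A) a.

Definition quasi_unipotent (R : realType) (n : nat) (A : 'M[int]_n) : Prop :=
  forall a : R[i], complex_eigenvalue A a -> exists2 k, (0 < k)%N & k.-unity_root a.

Definition dist_int (R : realType) (x : R) : R :=
  inf [set `|x - m%:~R| | m in [set: int]].

(* `|k| is the sup norm; as c is arbitrary, any other norm on R^p
   defines the same vectors *)
Definition diophantine (R : realType) (p : nat) (alpha : 'cV[R]_p) : Prop :=
  exists r c : R, [/\ 0 < r, 0 < c &
    forall k : 'cV[int]_p, k != 0 ->
      c * `|intmx R k| `^ (- r) <= dist_int (\sum_i (k i 0)%:~R * alpha i 0)].

Definition Zn_periodic (R : realType) (p : nat) (T : Type) (F : 'cV[R]_p -> T) :
    Prop :=
  forall x (k : 'cV[int]_p), F (x + intmx R k) = F x.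

Definition torus_add (R : realType) (n : nat) (s t : torus R n) : torus R n :=
  proj_torus (repr s + repr t).

(* Normalized Haar measure: the translation-invariant Borel probability measure *)
Definition is_haar (R : realType) (n : nat) (mu : probability (borel_torus R n) R) :
    Prop :=
  forall (s : torus R n) (A : set (borel_torus R n)), measurable A ->
    mu (torus_add s @` A) = mu A.

(* Integral over T^p of a Z^p-periodic function, which is evaluated at an
   arbitrary representative *)
Definition torus_mean (R : realType) (p q : nat)
    (mu : probability (borel_torus R p) R) (F : 'cV[R]_p -> 'cV[R]_q) : 'cV[R]_q :=
  \col_i \int[mu]_(t in [set: borel_torus R p]) F (repr (t : torus R p)) i 0.

Definition dotv (R : realType) (n : nat) (x y : 'cV[R]_n) : R :=
  \sum_i x i 0 * y i 0.

Definition kernel_set (R : realType) (m n : nat) (A : 'M[R]_(m, n)) : set 'cV[R]_n :=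
  [set x | A *m x = 0].

(* For a linear subspace V of R^n there is exactly one such y *)
Definition orth_proj (R : realType) (n : nat) (V : set 'cV[R]_n) (x : 'cV[R]_n) :
    'cV[R]_n :=
  get [set y | V y /\ forall v, V v -> dotv (x - y) v = 0].

(* Main.v *)
Require Import Defs.
From mathcomp Require Import all_boot all_order all_algebra.
From mathcomp Require Import complex ring lra zify.
From mathcomp Require Import all_classical all_reals all_analysis measurable_realfun.
Import Order.TTheory GRing.Theory Num.Theory.
Import numFieldNormedType.Exports.
Set Implicit Arguments.
Unset Strict Implicit.
Unset Printing Implicit Defensive.
Local Open Scope classical_set_scope.
Local Open Scope ring_scope.

(** Everything reduces to one functional equation on the base [T^p]. If a smooth
    periodic [w] and a constant vector [b] satisfy

      F X = b + w (X + alpha) - B (w X),                                    (E)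

    then the fibred translation [(X, Y) |-> (X, Y - w X)] conjugates [phi] to the
    affine map with translation [(alpha, b)] ([skew_product_conjugate]).

    Solving (E). The linear part is quasi-unipotent, so by Cayley-Hamilton
    [B^m - 1] is nilpotent for some [m > 0] ([quasi_unipotent_nilpotent]). Since
    [B^m - 1] is nilpotent, replacing the shift by [alpha] and [B] by the shift by
    [m alpha] and [B^m] leaves a triangular system of scalar equations, each of
    the form [f x = b + w (x + alpha') - w x] with [alpha' = m alpha], again
    Diophantine ([nilpotent_equation]); a telescoping sum then comes back from
    [B^m] to [B] ([twisted_cohomological_equation]).

    The scalar equation ([cohomological_equation]) is solved without integrals.
    Sample [f] on the grid of mesh [2^-n] and take its discrete Fourier
    coefficients. Summation by parts bounds them by any negative power of the
    frequency, uniformly in [n] ([rapid_fourier_coef]), and the trigonometric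
    polynomial with these coefficients interpolates [f] on the grid, so it tends to
    [f] ([trig_fourier_cvg]). Dividing the [k]-th coefficient by
    [2 sin (pi <k, alpha>)], with a change of phase, solves the equation for this polynomial, up to the
    frequency zero; the Diophantine condition makes the divisor cost only a power
    of [k], so the solutions [w_n] still have uniformly rapidly decreasing
    coefficients ([rapid_solve]). Their pointwise limit along an ultrafilter on
    the natural numbers exists because they are bounded, and it is smooth because the
    Taylor estimates of the [w_n] are uniform in [n] ([smooth_trig_lim]).

    The constant. Integrating (E) against the Haar measure gives
    [b - beta = - (I - B) (mean of w)]. On the other hand [beta - beta1] is
    orthogonal to the kernel of the transpose of [I - B], hence lies in the range
    of [I - B] ([orth_proj_range]). So [b - beta1] is in that range too, and adding
    a constant to [w] turns [b] into [beta1].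

    Minimality. Let [A] be the linear part and suppose that it has an eigenvalue
    [a <> 1], with [a^m = 1]. Then [1 + a + ... + a^(m-1) = 0], so the integer matrix
    [1 + A + ... + A^(m-1)] is singular and some nonzero integer row [v] annihilates
    it. For the affine map conjugate to [phi] the character
    [z |-> v z mod 1] is then invariant under the [m]-th iterate, so that it takes
    finitely many values on each orbit, although it is onto the circle: no orbit is
    dense ([minimal_eigenvalue]). *)

(** * Smooth maps in the sense of iterated directional derivatives *)

Section SmoothCalculus.
Variable R : realType.
Implicit Types U V W : normedModType R.

Lemma smooth_continuous U V (f : U -> V) : smooth f -> continuous f.
Proof. by move=> /(_ 0). Qed.

Lemma smooth_derivable U V (f : U -> V) x v : smooth f -> derivable f x v.
Proof. by move=> /(_ 1) [] /(_ x v). Qed.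

Lemma smooth_derive U V (f : U -> V) v : smooth f -> smooth (fun x => 'D_v f x).
Proof. by move=> sf k; have [_ /(_ v)] := sf k.+1. Qed.

Lemma Ck_cst U V k (c : V) : Ck k (fun _ : U => c).
Proof.
elim: k c => [|k IH] c /=; first exact: cst_continuous.
split=> [x v|v]; first exact: derivable_cst.
rewrite (_ : (fun x => _) = (fun _ => 0 : V)); first exact: IH.
by apply/funext => x; apply: derive_cst.
Qed.

Lemma Ck_add U V k (f g : U -> V) : Ck k f -> Ck k g -> Ck k (fun x => f x + g x).
Proof.
elim: k f g => [|k IH] f g /=.
  by move=> cf cg x; apply: cvgD; [exact: cf|exact: cg].
move=> [df cf] [dg cg]; split=> [x v|v]; first exact: derivableD.
rewrite (_ : (fun x => _) = (fun x => 'D_v f x + 'D_v g x)); first exact: IH.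
by apply/funext => x; rewrite -deriveD.
Qed.

(** A continuous linear map commutes with difference quotients. In the same way,
    precomposition with an affine map, below, turns the derivative along [L v] into
    the derivative along [v]. *)
Lemma Ck_linear_comp U V W k (L : {linear V -> W}) (f : U -> V) :
  continuous L -> Ck k f -> Ck k (fun x => L (f x)).
Proof.
move=> cL; elim: k f => [|k IH] f /=.
  by move=> cf x; apply: continuous_comp; [exact: cf|exact: cL].
move=> [df cf].
have H x v : h^-1 *: (L (f (h *: v + x)) - L (f x)) @[h --> 0^'] --> L ('D_v f x).
  have -> : (fun h => h^-1 *: (L (f (h *: v + x)) - L (f x))) =
      L \o (fun h => h^-1 *: (f (h *: v + x) - f x)).
    apply/funext => h; by rewrite /= linearZ_LR (raddfB L).
  apply: cvg_comp; first exact: (df x v). exact: cL.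
split=> [x v|v]; first by apply/cvg_ex; exists (L ('D_v f x)); apply: H.
rewrite (_ : (fun x => _) = (fun x => L ('D_v f x))); first exact/IH/cf.
by apply/funext => x; apply/cvg_lim => //; apply: H.
Qed.

Lemma Ck_comp_affine U V W k (L : {linear W -> U}) (a : U) (f : U -> V) :
  continuous L -> Ck k f -> Ck k (fun x => f (L x + a)).
Proof.
move=> cL; elim: k f => [|k IH] f /=.
  move=> cf x; apply: (@continuous_comp _ _ _ (fun x => L x + a) f); last exact: cf.
  by apply: cvgD; [exact: cL|exact: cvg_cst].
move=> [df cf].
have E x v : (fun h : R => h^-1 *: (f (L (h *: v + x) + a) - f (L x + a))) =
      (fun h : R => h^-1 *: (f (h *: L v + (L x + a)) - f (L x + a))).
    by apply/funext => h /=; rewrite linearP addrA.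
split=> [x v|v].
  by rewrite /derivable /= E; apply: df.
rewrite (_ : (fun x => _) = (fun x => 'D_(L v) f (L x + a))); first exact: (IH _ (cf (L v))).
by apply/funext => x; rewrite /derive /= E.
Qed.

Lemma continuous_mx (T : topologicalType) m n (f : T -> 'M[R]_(m, n)) :
  (forall i j, continuous (fun x => f x i j)) -> continuous f.
Proof.
move=> cf x; apply/cvgrPdist_le => /= e e0; near=> y.
rewrite [leLHS]/Num.Def.normr/= mx_normrE (bigmax_le _ (ltW e0))//= => -[i j] _.
rewrite !mxE; move: i j; near: y.
apply: filter_forall => i; apply: filter_forall => j /=.
exact: (cvgrPdist_le _ _).1 (cf i j x) e e0.
Unshelve. all: by end_near. Qed.

Lemma continuous_add (T : topologicalType) V (f g : T -> V) :
  continuous f -> continuous g -> continuous (fun x => f x + g x).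
Proof. by move=> cf cg x; apply: cvgD; [exact: cf|exact: cg]. Qed.

Lemma continuous_sum (T : topologicalType) V (I : Type) (r : seq I) (P : pred I)
    (F : I -> T -> V) :
  (forall i, continuous (F i)) -> continuous (fun x => \sum_(i <- r | P i) F i x).
Proof.
move=> cF; elim: r => [|i r IH].
  rewrite (_ : (fun x => _) = fun=> 0); first exact: cst_continuous.
  by apply/funext => x; rewrite big_nil.
rewrite (_ : (fun x => _) = fun x => (if P i then F i x else 0)
   + \sum_(i <- r | P i) F i x); last first.
  by apply/funext => x; rewrite big_cons; case: ifP; rewrite ?add0r.
apply: continuous_add; last exact: IH.
by case: (P i); [exact: cF|exact: cst_continuous].
Qed.

Lemma continuous_mulmx m n l (A : 'M[R]_(m, n)) :
  continuous (mulmx A : 'M[R]_(n, l) -> 'M[R]_(m, l)).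
Proof.
apply: continuous_mx => i j.
rewrite (_ : (fun x => _) = fun x : 'M[R]_(n, l) => \sum_k A i k * x k j); last first.
  by apply/funext => x; rewrite mxE.
apply: continuous_sum => k x.
apply: (@continuousM R _ (fun=> A i k) (fun x : 'M[R]_(n, l) => x k j)).
  exact: cst_continuous.
exact: coord_continuous.
Qed.

Lemma Ck_mx U m n k (f : U -> 'M[R]_(m, n)) :
  (forall i j, Ck k (fun x => f x i j : R)) -> Ck k f.
Proof.
elim: k f => [|k IH] f /=; first exact: continuous_mx.
move=> df; have D x v : derivable f x v.
  by apply/derivable_mxP => i j; have [d _] := df i j; apply: d.
split=> // v; apply: IH => i j; have [_ /(_ v)] := df i j.
by congr (Ck _); apply/funext => x; rewrite derive_mx// mxE.
Qed.

Lemma Ck_coord U m n k (f : U -> 'M[R]_(m, n)) i j :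
  Ck k f -> Ck k (fun x => f x i j : R).
Proof.
elim: k f => [|k IH] f /=.
  move=> cf x; apply: (@continuous_comp _ _ _ f (fun M : 'M[R]_(m, n) => M i j)).
    exact: cf.
  exact: coord_continuous.
move=> [df cf]; split=> [x v|v]; first exact: (proj1 (derivable_mxP f x v) (df x v) i j).
rewrite (_ : (fun x => _) = fun x => ('D_v f x) i j); first exact/IH/cf.
by apply/funext => x; rewrite derive_mx// mxE.
Qed.

Lemma smooth_cst U V (c : V) : smooth (fun _ : U => c).
Proof. by move=> k; apply: Ck_cst. Qed.

Lemma smooth_add U V (f g : U -> V) :
  smooth f -> smooth g -> smooth (fun x => f x + g x).
Proof. by move=> sf sg k; apply: Ck_add. Qed.

Lemma smooth_mulmx U m n l (A : 'M[R]_(m, n)) (f : U -> 'M[R]_(n, l)) :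
  smooth f -> smooth (fun x => A *m f x).
Proof.
by move=> sf k; apply: (@Ck_linear_comp _ _ _ k (mulmx A));
  [exact: continuous_mulmx|exact: sf].
Qed.

Lemma smooth_scale U V (c : R) (f : U -> V) : smooth f -> smooth (fun x => c *: f x).
Proof.
by move=> sf k; apply: (@Ck_linear_comp _ _ _ k ( *:%R c));
  [exact: scaler_continuous|exact: sf].
Qed.

Lemma smooth_comp_affine V m n (A : 'M[R]_(m, n)) (a : 'cV[R]_m) (f : 'cV[R]_m -> V) :
  smooth f -> smooth (fun x : 'cV[R]_n => f (A *m x + a)).
Proof.
by move=> sf k; apply: (@Ck_comp_affine _ _ _ k (mulmx A));
  [exact: continuous_mulmx|exact: sf].
Qed.

Lemma smooth_shift V m (a : 'cV[R]_m) (f : 'cV[R]_m -> V) :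
  smooth f -> smooth (fun x => f (x + a)).
Proof.
move=> sf; under eq_fun do rewrite -[X in X + _]mul1mx.
exact: smooth_comp_affine.
Qed.

Lemma smooth_id m : smooth (fun x : 'cV[R]_m => x).
Proof.
case=> [|k] /=; first by move=> x.
split=> [x v|v]; first exact: derivable_id.
by under eq_fun do rewrite derive_id; exact: Ck_cst.
Qed.

Lemma smooth_mx U m n (f : U -> 'M[R]_(m, n)) :
  (forall i j, smooth (fun x => f x i j : R)) -> smooth f.
Proof. by move=> sf k; apply: Ck_mx => i j; apply: sf. Qed.

Lemma smooth_coord U m n (f : U -> 'M[R]_(m, n)) i j :
  smooth f -> smooth (fun x => f x i j : R).
Proof. by move=> sf k; apply: Ck_coord. Qed.

Lemma derive_shift_arg U V (f : U -> V) (a x v : U) :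
  'D_v (fun y => f (y + a)) x = 'D_v f (x + a).
Proof. by rewrite /derive /=; under eq_fun do rewrite -addrA. Qed.

(** The mean value theorem applied to [t |-> f (x + t *: v)]. *)
Lemma le_derive_increment U (f : U -> R) (K h : R) (x v : U) :
  smooth f -> (forall y, `|'D_v f y| <= K) -> 0 <= h ->
  `|f (x + h *: v) - f x| <= h * K.
Proof.
move=> sf fK h0; pose g t := f (x + t *: v).
have dg (t : R) : is_derive t (1 : R) g ('D_v f (x + t *: v)).
  have E : (fun s : R => s^-1 *: (g (s *: 1 + t) - g t)) =
      (fun s : R => s^-1 *: (f (s *: v + (x + t *: v)) - f (x + t *: v))).
    by apply/funext => s; rewrite /g [s *: 1]mulr1 scalerDl addrCA.
  apply: DeriveDef; first by rewrite /derivable /= E; apply: smooth_derivable.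
  by rewrite /derive /= E.
have [|c _] := @MVT_segment R g (fun t => 'D_v f (x + t *: v)) 0 h h0 (fun t _ => dg t).
  apply: continuous_subspaceT => t.
  by apply: differentiable_continuous; apply/derivable1_diffP; case: (dg t).
rewrite /g scale0r addr0 subr0 => ->.
by rewrite normrM (ger0_norm h0) mulrC ler_wpM2l.
Qed.

(** Every orbit of [Z^p] meets the unit cube, which is compact. *)
Lemma periodic_bounded p (f : 'cV[R]_p -> R) :
  continuous f -> Zn_periodic f -> exists K, forall x, `|f x| <= K.
Proof.
move=> cf pf; pose A := [set v : 'rV[R]_p | forall i, `[0, 1]%classic (v ord0 i)].
have cA : compact A.
  by apply: (@rV_compact R p (fun=> `[0, 1]%classic)) => i; apply: segment_compact.
have ctr : continuous (fun v : 'rV[R]_p => v^T : 'cV[R]_p).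
  by apply: continuous_mx => i j; under eq_fun do rewrite mxE; apply: coord_continuous.
have cg : continuous (fun v : 'rV[R]_p => f v^T).
  by move=> v; apply: (@continuous_comp _ _ _ (fun v : 'rV[R]_p => v^T) f);
    [exact: ctr|exact: cf].
have : compact ((fun v : 'rV[R]_p => f v^T) @` A).
  by apply: continuous_compact => //; apply: continuous_subspaceT.
move=> /compact_bounded [M [_ /(_ (M + 1))]]; rewrite ltrDl ltr01 => /(_ isT) HM.
exists (M + 1) => x.
pose k : 'cV[int]_p := \col_i - Num.floor (x i 0).
rewrite -(pf x k); apply: HM; exists (x + intmx R k)^T; rewrite ?trmxK//.
move=> i; rewrite /= in_itv /= !mxE rmorphN /=.
have := floor_itv (x i 0); rewrite rmorphD /= => /andP[].
by lra.
Qed.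

End SmoothCalculus.

(** * Inequalities for sine and cosine *)

Section TrigInequalities.
Variable R : realType.
Implicit Types x y s t : R.

Lemma ler_norm_sin x : `|sin x| <= `|x|.
Proof.
wlog x0 : x / 0 <= x => [H|].
  have [/H//|/ltW x0] := leP 0 x.
  by have := H (- x); rewrite sinN !normrN; apply; rewrite oppr_ge0.
have [|c _] := @MVT_segment R sin cos 0 x x0 (fun c _ => is_derive_sin c).
  by apply: continuous_subspaceT; apply: continuous_sin.
rewrite sin0 !subr0 => ->; rewrite normrM.
by rewrite ler_piMl ?cos_max.
Qed.

Lemma oneBcos x : 1 - cos x = 2 * sin (x / 2) ^+ 2.
Proof.
have -> : cos x = cos (x / 2) ^+ 2 *+ 2 - 1.
  by rewrite -cos_mulr2n; congr cos; field.
by rewrite cos2sin2; ring.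
Qed.

Lemma norm_oneBcos_le x : `|1 - cos x| <= `|x|.
Proof.
rewrite oneBcos expr2 !normrM (ger0_norm (ler0n R 2)).
have := ler_norm_sin (x / 2); rewrite normrM (@ger0_norm _ 2^-1) ?invr_ge0//.
have := sin_max (x / 2); have := normr_ge0 (sin (x / 2)); nra.
Qed.

Lemma norm_oneBcos_le_sqr x : `|1 - cos x| <= x ^+ 2 / 2.
Proof.
rewrite oneBcos expr2 !normrM (ger0_norm (ler0n R 2)).
have := ler_norm_sin (x / 2); rewrite normrM (@ger0_norm _ 2^-1) ?invr_ge0//.
rewrite -(real_normK (num_real x)); have := normr_ge0 (sin (x / 2)); nra.
Qed.

(** The mean value theorem for [sin x - x], whose derivative is [cos x - 1]; every
    estimate on [sin x - x] below comes from one on [1 - cos c]. *)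
Lemma sinB_id_MVT x : exists2 c, `|c| <= `|x| & sin x - x = (cos c - 1) * x.
Proof.
wlog x0 : x / 0 <= x => [H|].
  have [/H//|/ltW x0] := leP 0 x.
  have [|c cx E] := H (- x); first by rewrite oppr_ge0.
  by exists c; [rewrite -[leRHS]normrN|move: E; rewrite sinN; lra].
have D c : is_derive (c : R) (1 : R) (fun y => sin y - y) (cos c - 1).
  by apply: is_deriveB.
have [|c] := @MVT_segment R _ _ 0 x x0 (fun c _ => D c).
  apply: continuous_subspaceT => t.
  by apply: differentiable_continuous; apply/derivable1_diffP; case: (D t).
rewrite in_itv /= sin0 !subr0 => /andP[c0 cx] E; exists c => //.
by rewrite !ger0_norm.
Qed.

Lemma norm_sinB_id_le x : `|sin x - x| <= x ^+ 2.
Proof.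
have [c cx ->] := sinB_id_MVT x; rewrite normrM distrC.
rewrite -(real_normK (num_real x)) expr2 ler_wpM2r//.
exact: le_trans (norm_oneBcos_le c) cx.
Qed.

(** The constant [1 / 4] is not sharp: [sin x >= x / 2] on [[0, 1]] by Taylor, and
    beyond [1] the sine increases while [x <= pi / 2 < 2]. *)
Lemma sin_ge_linear x : 0 <= x <= pi / 2 -> x / 4 <= sin x.
Proof.
move=> /andP[x0 xp].
have small y : 0 <= y -> y <= 1 -> y / 2 <= sin y.
  move=> y0 y1; have [c cy E] := sinB_id_MVT y.
  have := norm_oneBcos_le_sqr c; rewrite -(real_normK (num_real c)).
  move: cy E; rewrite (ger0_norm y0) => cy E.
  have := ler_norm (1 - cos c); have := normr_ge0 c => c0 l1 l2.
  have : 1 - cos c <= 1 / 2 by nra.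
  nra.
have [x1|x1] := leP x 1; first by have := small x x0 x1; lra.
have s1 : 1 / 2 <= sin 1 :> R by apply: small.
have : sin 1 < sin x.
  have := @pihalf_ge1 R; have := @pi_ge0 R => ? ?.
  by rewrite ltr_sin // in_itv /=; apply/andP; split; lra.
by have := @pihalf_lt2 R; lra.
Qed.

Lemma norm_sin_pi_ge s : `|s| <= 1 / 2 -> `|s| / 4 <= `|sin (pi * s)|.
Proof.
wlog s0 : s / 0 <= s => [H|].
  have [/H//|/ltW s0] := leP 0 s => ls.
  have := H (- s); rewrite mulrN sinN !normrN; apply => //.
  by rewrite oppr_ge0.
rewrite (ger0_norm s0) => s2; have p2 := @pi_ge2 R.
apply: le_trans (ler_norm _).
have := @sin_ge_linear (pi * s); rewrite mulr_ge0 ?pi_ge0//=.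
by move=> /(_ ltac:(nra)); nra.
Qed.

Lemma norm_sinDpi_int x (m : int) : `|sin (x + pi * m%:~R)| = `|sin x|.
Proof.
have N (k : nat) y : `|sin (y + pi * k%:R)| = `|sin y|.
  elim: k y => [|k IH] y; first by rewrite mulr0 addr0.
  by rewrite -natr1 mulrDr mulr1 addrA sinDpi normrN.
case: m => k; first by rewrite N.
by rewrite NegzE mulrNz mulrN -(N k.+1 (x - _)) subrK.
Qed.

(** Links the Diophantine condition, stated with the distance to the integers, to
    the small divisors, which are values of the sine. *)
Lemma norm_sin_pi_ge_dist_int x : dist_int x / 4 <= `|sin (pi * x)|.
Proof.
pose m := Num.floor (x + 1 / 2).
have := floor_itv (x + 1 / 2); rewrite -/m rmorphD /= => /andP[m1 m2].
have ls : `|x - m%:~R| <= 1 / 2 by rewrite ler_norml; apply/andP; split; lra.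
have -> : pi * x = pi * (x - m%:~R) + pi * m%:~R by ring.
rewrite norm_sinDpi_int; apply: le_trans (norm_sin_pi_ge ls).
rewrite ler_pM2r; last by rewrite invr_gt0.
apply: ge_inf; last by exists m.
by exists 0 => _ [k _ <-].
Qed.

Lemma cosD2pi_int x (m : int) : cos (x + 2 * pi * m%:~R) = cos x.
Proof.
rewrite mulr_natl.
have N (k : nat) y : cos (y + pi *+ 2 * k%:R) = cos y.
  elim: k y => [|k IH] y; first by rewrite mulr0 addr0.
  by rewrite -natr1 mulrDr mulr1 addrA cosD2pi.
case: m => k; first by rewrite N.
by rewrite NegzE mulrNz mulrN -(N k.+1 (x - _)) subrK.
Qed.

Lemma sinD2pi_int x (m : int) : sin (x + 2 * pi * m%:~R) = sin x.
Proof. by rewrite -!cosBpihalf addrAC cosD2pi_int. Qed.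

Local Lemma mulr_le_of_le1 (a b c : R) : 0 <= a -> a <= 1 -> 0 <= b -> b <= c -> a * b <= c.
Proof. by move=> a0 a1 b0 bc; apply: le_trans (ler_piMl _ _) bc. Qed.

Lemma cosD_lipschitz x s : `|cos (x + s) - cos x| <= 2 * `|s|.
Proof.
have -> : cos (x + s) - cos x = - (cos x * (1 - cos s)) - sin x * sin s.
  by rewrite cosD; ring.
rewrite (le_trans (ler_normB _ _))// normrN !normrM.
rewrite mulr_natl mulr2n; apply: lerD.
  by apply: mulr_le_of_le1; rewrite ?cos_max ?norm_oneBcos_le.
by apply: mulr_le_of_le1; rewrite ?sin_max ?ler_norm_sin.
Qed.

Lemma sinD_lipschitz x s : `|sin (x + s) - sin x| <= 2 * `|s|.
Proof. by rewrite -!cosBpihalf addrAC cosD_lipschitz. Qed.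

Lemma cosD_taylor x s : `|cos (x + s) - cos x + s * sin x| <= 2 * s ^+ 2.
Proof.
have -> : cos (x + s) - cos x + s * sin x =
    - (cos x * (1 - cos s)) - sin x * (sin s - s).
  by rewrite cosD; ring.
rewrite (le_trans (ler_normB _ _))// normrN !normrM.
rewrite mulr_natl mulr2n; apply: lerD.
  apply: mulr_le_of_le1; rewrite ?cos_max//.
  by apply: le_trans (norm_oneBcos_le_sqr s) _; have := sqr_ge0 s; lra.
by apply: mulr_le_of_le1; rewrite ?sin_max ?norm_sinB_id_le.
Qed.

Lemma sinD_taylor x s : `|sin (x + s) - sin x - s * cos x| <= 2 * s ^+ 2.
Proof.
by have := cosD_taylor (x - pi / 2) s; rewrite [x - _ + s]addrAC !cosBpihalf sinBpihalf mulrN.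
Qed.

End TrigInequalities.

(** * Trigonometric polynomials with uniformly rapidly decreasing coefficients *)

Section TrigFamilies.
Variables (R : realType) (p : nat).

Definition angle (k : 'cV[int]_p) (x : 'cV[R]_p) : R :=
  2 * pi * \sum_i (k i 0)%:~R * x i 0.

Definition weight (k : 'cV[int]_p) : R := 1 + `|intmx R k|.

(** The box of frequencies is centred, with [|k_i| <= N / 2], so that [|sin (pi k_i / N)|]
    is bounded below by a multiple of [|k_i| / N]. *)
Definition freq (N : nat) (t : {ffun 'I_p -> 'I_N}) : 'cV[int]_p :=
  \col_i ((t i)%:Z - (N./2)%:Z).

Lemma angleD k x y : angle k (x + y) = angle k x + angle k y.
Proof.
rewrite /angle -mulrDr -big_split /=; congr (_ * _).
by apply: eq_bigr => i _; rewrite mxE mulrDr.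
Qed.

Lemma angleZ k c x : angle k (c *: x) = c * angle k x.
Proof.
rewrite /angle mulrCA; congr (_ * _); rewrite mulr_sumr.
by apply: eq_bigr => i _; rewrite mxE mulrCA.
Qed.

Lemma angle_int k (m : 'cV[int]_p) :
  angle k (intmx R m) = 2 * pi * (\sum_i k i 0 * m i 0)%:~R.
Proof.
rewrite /angle rmorph_sum /=; congr (_ * _).
by apply: eq_bigr => i _; rewrite mxE rmorphM.
Qed.

Lemma ler_norm_coord m n (A : 'M[R]_(m, n)) i j : `|A i j| <= `|A|.
Proof.
rewrite [leRHS]/Num.Def.normr/= mx_normrE.
exact: (le_bigmax _ (fun ij : 'I_m * 'I_n => `|A ij.1 ij.2|) (i, j)).
Qed.

Lemma weight_ge1 k : 1 <= weight k.
Proof. by rewrite lerDl. Qed.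

Lemma weight_gt0 k : 0 < weight k.
Proof. exact: lt_le_trans ltr01 (weight_ge1 k). Qed.

Lemma weight_ge_coord (k : 'cV[int]_p) i : 1 + `|(k i 0)%:~R| <= weight k.
Proof. by rewrite lerD2l; have := ler_norm_coord (intmx R k) i 0; rewrite mxE. Qed.

Lemma norm_angle_le k x : `|angle k x| <= 2 * pi * p%:R * `|x| * weight k.
Proof.
have tp0 : 0 <= 2 * pi :> R by rewrite mulr_ge0 ?pi_ge0.
rewrite /angle normrM (ger0_norm tp0) -(mulrA (2 * pi)) -(mulrA (2 * pi)).
rewrite ler_wpM2l//.
apply: le_trans (ler_norm_sum _ _ _) _.
apply: (@le_trans _ _ (\sum_(i < p) `|x| * weight k)).
  apply: ler_sum => i _; rewrite normrM mulrC ler_pM ?ler_norm_coord//.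
  by apply: le_trans (weight_ge_coord k i); rewrite lerDr.
by rewrite sumr_const card_ord -[leLHS]mulr_natl mulrA.
Qed.

(** [s / (1 + |s|)] increases by at least [(1 + |s|)^-2 / 2] over a unit step, so
    that the sum telescopes. *)
Lemma sum_inv_sqr_le (h N : nat) :
  \sum_(j < N) (1 + `|j%:R - h%:R : R|) ^- 2 <= 4 :> R.
Proof.
pose g (s : R) := s / (1 + `|s|).
have gb s : `|g s| <= 1.
  rewrite normrM normfV (@ger0_norm _ (1 + _)) ?addr_ge0//.
  by rewrite ler_pdivrMr ?mul1r ?lerDr// ltr_pwDl.
have step (z : int) : (1 + `|z%:~R : R|) ^- 2 <= 2 * (g ((z + 1)%:~R) - g z%:~R).
  rewrite /g rmorphD /=; case: (lerP 0 z) => [z0|z0].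
    have s0 : 0 <= z%:~R :> R by rewrite ler0z.
    move: (z%:~R) s0 => s s0; rewrite !ger0_norm ?addr_ge0//.
    rewrite -subr_ge0; have -> : 2 * ((s + 1) / (1 + (s + 1)) - s / (1 + s)) -
      (1 + s) ^- 2 = s / ((1 + s) ^+ 2 * (2 + s)).
      by field; do ?[apply/andP; split]; (apply: lt0r_neq0; lra) || (apply: ltr0_neq0; lra).
    by rewrite divr_ge0// mulr_ge0 ?sqr_ge0//; lra.
  have s0 : z%:~R <= -1 :> R by rewrite -[-1]/((-1)%:~R) ler_int; lia.
  move: (z%:~R) s0 => s s0; rewrite !ler0_norm; [|lra|lra].
  rewrite -subr_ge0; have -> : 2 * ((s + 1) / (1 - (s + 1)) - s / (1 - s)) -
    (1 - s) ^- 2 = (2 - s) / ((1 - s) ^+ 2 * (- s)).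
    by field; do ?[apply/andP; split]; (apply: lt0r_neq0; lra) || (apply: ltr0_neq0; lra).
  by rewrite divr_ge0 ?mulr_ge0 ?sqr_ge0//; lra.
apply: (@le_trans _ _ (\sum_(0 <= j < N) 2 * (g (j.+1%:R - h%:R) - g (j%:R - h%:R)))).
  rewrite big_mkord; apply: ler_sum => j _.
  have := step (j%:Z - h%:Z); rewrite !rmorphD !rmorphN /= => H; apply: le_trans H _.
  by rewrite -(natr1 j) [_ + 1 - _]addrAC.
rewrite -mulr_sumr telescope_sumr//.
have := gb (N%:R - h%:R); have := gb (0%:R - h%:R); rewrite !ler_norml.
by move=> /andP[? ?] /andP[? ?]; lra.
Qed.

(** The weight dominates each [1 + |k_i|], so the sum over the box is bounded by a
    product of [p] one-dimensional sums. *)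
Lemma sum_weight_le N : \sum_(t : {ffun 'I_p -> 'I_N}) weight (freq t) ^- (2 * p) <= 4 ^+ p.
Proof.
apply: (@le_trans _ _ (\sum_(t : {ffun 'I_p -> 'I_N})
    \prod_i (1 + `|(t i)%:R - (N./2)%:R : R|) ^- 2)).
  apply: ler_sum => t _; rewrite exprM -exprVn -[X in _ ^+ X]card_ord -prodr_const.
  apply: ler_prod => i _; rewrite invr_ge0 exprn_ge0 ?(ltW (weight_gt0 _))//=.
  rewrite lef_pV2 ?posrE ?exprn_gt0 ?weight_gt0 ?ltr_pwDl// ler_sqr ?nnegrE ?addr_ge0//.
  have := weight_ge_coord (freq t) i.
  by rewrite mxE rmorphD rmorphN.
rewrite -(bigA_distr_bigA (fun (_ : 'I_p) (j : 'I_N) => (1 + `|j%:R - (N./2)%:R : R|) ^- 2)).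
rewrite -[X in _ ^+ X]card_ord -prodr_const; apply: ler_prod => i _.
by rewrite sum_inv_sqr_le andbT sumr_ge0.
Qed.

(** A sequence of coefficient systems, the [n]-th one being indexed by the box of
    frequencies of side [2 ^ n]. *)
Definition coef_family := forall n, {ffun 'I_p -> 'I_(2 ^ n)} -> R.

(** The bound [C] depends on the power [M] but not on [n]: this uniformity is what
    survives in the limit. *)
Definition rapid (a : coef_family) := forall M : nat, exists C : R,
  forall n (t : {ffun 'I_p -> 'I_(2 ^ n)}), `|a n t| * weight (freq t) ^+ M <= C.

Definition trig (a b : coef_family) (n : nat) (x : 'cV[R]_p) : R :=
  \sum_(t : {ffun 'I_p -> 'I_(2 ^ n)})
    (a n t * cos (angle (freq t) x) + b n t * sin (angle (freq t) x)).

Lemma rapid_sum (a b : coef_family) (M : nat) : rapid a -> rapid b ->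
  exists2 K : R, 0 <= K & forall n, \sum_(t : {ffun 'I_p -> 'I_(2 ^ n)})
    (`|a n t| + `|b n t|) * weight (freq t) ^+ M <= K.
Proof.
move=> /(_ (M + 2 * p)%N) [C1 H1] /(_ (M + 2 * p)%N) [C2 H2].
exists ((`|C1| + `|C2|) * 4 ^+ p) => [|n]; first by rewrite mulr_ge0 ?exprn_ge0 ?addr_ge0.
apply: (@le_trans _ _ (\sum_(t : {ffun 'I_p -> 'I_(2 ^ n)})
    (`|C1| + `|C2|) * weight (freq t) ^- (2 * p))).
  apply: ler_sum => t _; rewrite ler_pdivlMr ?exprn_gt0 ?weight_gt0//.
  rewrite -mulrA -exprD mulrDl lerD//.
    exact: le_trans (H1 n t) (ler_norm _).
  exact: le_trans (H2 n t) (ler_norm _).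
by rewrite -mulr_sumr ler_wpM2l ?sum_weight_le ?addr_ge0.
Qed.

(** Coefficients, on cosines and on sines, of the derivative in the direction [v]. *)
Definition derive_cos_coef (v : 'cV[R]_p) (b : coef_family) : coef_family :=
  fun n t => angle (freq t) v * b n t.
Definition derive_sin_coef (v : 'cV[R]_p) (a : coef_family) : coef_family :=
  fun n t => - angle (freq t) v * a n t.

(** Multiplying by a quantity of polynomial growth in the frequency, such as a
    derivative or the inverse of a small divisor, preserves rapid decrease. *)
Lemma rapid_mul_poly (a c : coef_family) (K : R) (L : nat) : rapid a ->
  (forall n t, `|c n t| <= K * weight (freq t) ^+ L * `|a n t|) -> rapid c.
Proof.
move=> ra ca M; have [C H] := ra (L + M)%N; exists (`|K| * C) => n t.
apply: le_trans (ler_wpM2r _ (ca n t)) _; first by rewrite exprn_ge0 ?(ltW (weight_gt0 _)).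
apply: (@le_trans _ _ (`|K| * (`|a n t| * weight (freq t) ^+ (L + M)))); last first.
  by rewrite ler_wpM2l.
rewrite exprD; have w0 := exprn_ge0 L (ltW (weight_gt0 (freq t))).
have w1 := exprn_ge0 M (ltW (weight_gt0 (freq t))).
rewrite [leLHS](_ : _ = K * (`|a n t| * (weight (freq t) ^+ L * weight (freq t) ^+ M))).
  by rewrite ler_wpM2r ?ler_norm// !mulr_ge0.
by ring.
Qed.

Lemma rapid_derive_cos v b : rapid b -> rapid (derive_cos_coef v b).
Proof.
move=> rb; apply: (@rapid_mul_poly b _ (2 * pi * p%:R * `|v|) 1) => // n t.
by rewrite /derive_cos_coef normrM ler_wpM2r// expr1 norm_angle_le.
Qed.

Lemma rapid_derive_sin v a : rapid a -> rapid (derive_sin_coef v a).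
Proof.
move=> ra; apply: (@rapid_mul_poly a _ (2 * pi * p%:R * `|v|) 1) => // n t.
by rewrite /derive_sin_coef normrM normrN ler_wpM2r// expr1 norm_angle_le.
Qed.

Lemma trig_bounded a b : rapid a -> rapid b ->
  exists K, forall n x, `|trig a b n x| <= K.
Proof.
move=> ra rb; have [K _ H] := rapid_sum 0 ra rb; exists K => n x.
apply: le_trans (ler_norm_sum _ _ _) _; apply: le_trans (H n).
apply: ler_sum => t _; rewrite expr0 mulr1; apply: le_trans (ler_normD _ _) _.
by rewrite lerD// normrM ler_piMr ?cos_max ?sin_max.
Qed.

Lemma trig_lipschitz a b : rapid a -> rapid b ->
  exists2 K, 0 <= K & forall n x y, `|trig a b n (x + y) - trig a b n x| <= K * `|y|.
Proof.
move=> ra rb; have [K K0 H] := rapid_sum 1 ra rb.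
pose c : R := 2 * (2 * pi * p%:R).
have c0 : 0 <= c by rewrite !mulr_ge0 ?pi_ge0.
exists (K * c) => [|n x y]; first exact: mulr_ge0.
rewrite /trig -sumrB; apply: le_trans (ler_norm_sum _ _ _) _.
apply: (@le_trans _ _ (\sum_(t : {ffun 'I_p -> 'I_(2 ^ n)})
    (`|a n t| + `|b n t|) * weight (freq t) ^+ 1 * (c * `|y|))); last first.
  by rewrite -mulr_suml -(mulrA K) ler_wpM2r// mulr_ge0.
apply: ler_sum => t _; rewrite expr1 angleD -(mulrA (_ + _)) mulrDl.
set A := angle _ x; set s := angle _ y.
have -> : a n t * cos (A + s) + b n t * sin (A + s) -
    (a n t * cos A + b n t * sin A) =
  a n t * (cos (A + s) - cos A) + b n t * (sin (A + s) - sin A) by ring.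
have B : 2 * `|s| <= weight (freq t) * (c * `|y|).
  have := norm_angle_le (freq t) y; rewrite /c => h.
  by rewrite mulrC -!mulrA; lra.
apply: le_trans (ler_normD _ _) _; rewrite !normrM lerD// ler_wpM2l//.
  exact: le_trans (cosD_lipschitz _ _) B.
exact: le_trans (sinD_lipschitz _ _) B.
Qed.

(** The trigonometric polynomials are never differentiated: this estimate, uniform
    in [n], is what identifies the derivative of their limit. *)
Lemma trig_taylor a b v : rapid a -> rapid b ->
  exists2 K, 0 <= K & forall n x (h : R), `|trig a b n (x + h *: v) - trig a b n x -
    h * trig (derive_cos_coef v b) (derive_sin_coef v a) n x| <= K * h ^+ 2.
Proof.
move=> ra rb; have [K K0 H] := rapid_sum 2 ra rb.
pose c : R := 2 * (2 * pi * p%:R * `|v|) ^+ 2.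
have c0 : 0 <= c by rewrite mulr_ge0 ?sqr_ge0.
exists (K * c) => [|n x h]; first exact: mulr_ge0.
rewrite /trig mulr_sumr -!sumrB; apply: le_trans (ler_norm_sum _ _ _) _.
apply: (@le_trans _ _ (\sum_(t : {ffun 'I_p -> 'I_(2 ^ n)})
    (`|a n t| + `|b n t|) * weight (freq t) ^+ 2 * (c * h ^+ 2))); last first.
  by rewrite -mulr_suml -(mulrA K) ler_wpM2r// mulr_ge0 ?sqr_ge0.
apply: ler_sum => t _; rewrite /derive_cos_coef /derive_sin_coef angleD angleZ.
set A := angle _ x; set s := angle _ v.
have S2 : 2 * (h * s) ^+ 2 <= weight (freq t) ^+ 2 * (c * h ^+ 2).
  have := norm_angle_le (freq t) v; rewrite -/s /c.
  set q := 2 * pi * p%:R * `|v|; move: (weight _) (weight_gt0 (freq t)) => w w0 sq.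
  have : s ^+ 2 <= (q * w) ^+ 2.
    rewrite -(real_normK (num_real s)) ler_sqr// nnegrE.
    exact: le_trans (normr_ge0 s) sq.
  move=> sq2; rewrite exprMn.
  rewrite [leRHS](_ : _ = 2 * (h ^+ 2 * (q * w) ^+ 2)); last by ring.
  by rewrite ler_wpM2l// ler_wpM2l// sqr_ge0.
have -> : a n t * cos (A + h * s) + b n t * sin (A + h * s)
    - (a n t * cos A + b n t * sin A)
    - h * (s * b n t * cos A + - s * a n t * sin A) =
  a n t * (cos (A + h * s) - cos A + h * s * sin A) +
  b n t * (sin (A + h * s) - sin A - h * s * cos A) by ring.
rewrite -(mulrA (_ + _)) mulrDl; apply: le_trans (ler_normD _ _) _; rewrite !(normrM (_ n t)).
rewrite lerD// ler_wpM2l//.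
  exact: le_trans (cosD_taylor _ _) S2.
exact: le_trans (sinD_taylor _ _) S2.
Qed.

End TrigFamilies.

(** * Limits along an ultrafilter *)

Section UltraLimits.
Variables (R : realType) (p : nat) (G : set_system nat).
Hypothesis GU : UltraFilter G.
#[local] Instance ultra_properfilter : ProperFilter G := @ultra_proper _ _ GU.

(** A bounded sequence has a cluster point by compactness, and an ultrafilter
    converges to any cluster point. This replaces the extraction of subsequences
    that converge at every point at once. *)
Lemma ultra_bounded_cvg (u : nat -> R) (K : R) :
  (forall n, `|u n| <= K) -> cvg (u n @[n --> G]).
Proof.
move=> uK; have := @segment_compact R (- K) K.
move=> /(_ (u @ G)) [|l [_ cl]].
  by apply: nearW => n; rewrite /= in_itv /= -ler_norml.
apply/cvg_ex; exists l => A /= Al.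
have [//|GA] := in_ultra_setVsetC (u @^-1` A) GU.
by have [y []] := cl (~` A) A GA Al.
Qed.

Lemma ultra_lim_norm_le (u : nat -> R) (K : R) :
  (forall n, `|u n| <= K) -> `|lim (u n @[n --> G])| <= K.
Proof.
move=> uK; have cu := ultra_bounded_cvg uK.
rewrite ler_norml; apply/andP; split.
  by apply: limr_ge => //; apply: nearW => n; have := uK n; rewrite ler_norml => /andP[].
by apply: limr_le => //; apply: nearW => n; have := uK n; rewrite ler_norml => /andP[].
Qed.

Definition trig_lim (a b : coef_family R p) (x : 'cV[R]_p) : R :=
  lim (trig a b n x @[n --> G]).

Lemma trig_lim_cvg a b x : rapid a -> rapid b ->
  trig a b n x @[n --> G] --> trig_lim a b x.
Proof.
move=> ra rb; have [K H] := trig_bounded ra rb.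
exact: (ultra_bounded_cvg (fun n => H n x)).
Qed.

(** Here and in the next lemma, an inequality whose constant is uniform in [n] passes
    to the limit. *)
Lemma trig_lim_lipschitz a b : rapid a -> rapid b ->
  exists2 K, 0 <= K & forall x y, `|trig_lim a b (x + y) - trig_lim a b x| <= K * `|y|.
Proof.
move=> ra rb; have [K K0 H] := trig_lipschitz ra rb; exists K => // x y.
have /cvg_lim <- // : trig a b n (x + y) - trig a b n x @[n --> G] -->
    trig_lim a b (x + y) - trig_lim a b x by apply: cvgB; exact: trig_lim_cvg.
exact: (ultra_lim_norm_le (fun n => H n x y)).
Qed.

Lemma trig_lim_taylor a b v : rapid a -> rapid b ->
  exists2 K, 0 <= K & forall x (h : R), `|trig_lim a b (x + h *: v) - trig_lim a b x -
    h * trig_lim (derive_cos_coef v b) (derive_sin_coef v a) x| <= K * h ^+ 2.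
Proof.
move=> ra rb; have [K K0 H] := trig_taylor v ra rb; exists K => // x h.
set da := derive_cos_coef v b; set db := derive_sin_coef v a.
have /cvg_lim <- // : trig a b n (x + h *: v) - trig a b n x - h * trig da db n x
    @[n --> G] --> trig_lim a b (x + h *: v) - trig_lim a b x - h * trig_lim da db x.
  apply: cvgB; first by apply: cvgB; exact: trig_lim_cvg.
  apply: cvgM; first exact: cvg_cst.
  by apply: trig_lim_cvg; [exact: rapid_derive_cos|exact: rapid_derive_sin].
exact: (ultra_lim_norm_le (fun n => H n x h)).
Qed.

Lemma cvg_difference_quotient (V : normedModType R) (f : V -> R) x v (l K : R) :
  (forall h : R, `|f (x + h *: v) - f x - h * l| <= K * h ^+ 2) ->
  h^-1 *: (f (h *: v + x) - f x) @[h --> 0^'] --> l.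
Proof.
move=> H; apply/cvgrPdist_le => e e0; near=> h.
have h0 : h != 0 by near: h; exact: nbhs_dnbhs_neq.
have -> : l - h^-1 *: (f (h *: v + x) - f x) =
    - (h^-1 * (f (x + h *: v) - f x - h * l)).
  by rewrite [h *: v + x]addrC [h^-1 *: _]/GRing.scale /=; field.
have Kh : `|K| * `|h| <= e.
  have : `|h| <= e / (`|K| + 1).
    by near: h; apply: dnbhs0_le; rewrite divr_gt0// ltr_pwDr.
  rewrite ler_pdivlMr ?ltr_pwDr// => ?; have := normr_ge0 h; nra.
rewrite normrN normrM normfV mulrC ler_pdivrMr ?normr_gt0//.
apply: le_trans (H h) _; apply: le_trans (_ : `|K| * `|h| * `|h| <= _); last first.
  by rewrite ler_wpM2r.
by rewrite -mulrA -expr2 real_normK ?num_real// ler_wpM2r ?sqr_ge0 ?ler_norm.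
Unshelve. all: by end_near. Qed.

Lemma lipschitz_continuous (V : normedModType R) (f : V -> R) (K : R) : 0 <= K ->
  (forall x y, `|f (x + y) - f x| <= K * `|y|) -> continuous f.
Proof.
move=> K0 H x; apply/cvgrPdist_le => e e0; near=> y.
have Ky : `|y - x| <= e / (K + 1).
  near: y; apply/nbhs_ballP; exists (e / (K + 1)) => /= [|y].
    by rewrite divr_gt0// ltr_pwDr.
  by rewrite -ball_normE /= distrC => /ltW.
rewrite distrC -[y](subrK x) [_ + x]addrC; apply: le_trans (H _ _) _.
move: Ky; rewrite ler_pdivlMr ?ltr_pwDr// => ?; have := normr_ge0 (y - x); nra.
Unshelve. all: by end_near. Qed.

(** The Taylor estimate shows that the limit has directional derivatives, which are
    limits of the same kind; hence the induction on the order. *)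
Lemma smooth_trig_lim a b : rapid a -> rapid b -> smooth (trig_lim a b).
Proof.
move=> ra rb k; elim: k a b ra rb => [|k IH] a b ra rb /=.
  have [K K0 H] := trig_lim_lipschitz ra rb.
  exact: lipschitz_continuous K0 H.
have D x v : h^-1 *: (trig_lim a b (h *: v + x) - trig_lim a b x) @[h --> 0^'] -->
    trig_lim (derive_cos_coef v b) (derive_sin_coef v a) x.
  have [K K0 H] := trig_lim_taylor v ra rb.
  exact: (cvg_difference_quotient (H x)).
split=> [x v|v].
  by apply/cvg_ex; exists (trig_lim (derive_cos_coef v b) (derive_sin_coef v a) x); apply: D.
rewrite (_ : (fun x => _) = trig_lim (derive_cos_coef v b) (derive_sin_coef v a)).
  by apply: IH; [exact: rapid_derive_cos|exact: rapid_derive_sin].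
by apply/funext => x; apply/cvg_lim => //; apply: D.
Qed.

Lemma trig_periodic (a b : coef_family R p) n : Zn_periodic (trig a b n).
Proof.
move=> x k; apply: eq_bigr => t _.
by rewrite angleD angle_int cosD2pi_int sinD2pi_int.
Qed.

Lemma trig_lim_periodic a b : Zn_periodic (trig_lim a b).
Proof. by move=> x k; rewrite /trig_lim; under eq_fun do rewrite trig_periodic. Qed.

End UltraLimits.

(** * The discrete Fourier transform on the grid of mesh 1/N *)

Section DiscreteFourier.
Variables (R : realType) (p : nat).

Section Grid.
Variable N : nat.
Hypothesis N0 : (0 < N)%N.
Implicit Types (t : {ffun 'I_p -> 'I_N}) (i : 'I_p).

Definition grid t : 'cV[R]_p := \col_i ((t i)%:R / N%:R).

(** Cyclic successor in the [i]-th coordinate. It permutes the index box, so sums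
    over the box are unchanged by it, both for grid points and for frequencies. *)
Definition next_index i t : {ffun 'I_p -> 'I_N} :=
  [ffun j => if j == i then ordS (t j) else t j].

Let N_neq0 : N%:R != 0 :> R.
Proof. by rewrite pnatr_eq0 -lt0n. Qed.

Lemma sum_next_index i (h : {ffun 'I_p -> 'I_N} -> R) : \sum_t h (next_index i t) = \sum_t h t.
Proof.
rewrite [RHS](reindex (next_index i))//; apply: onW_bij.
exists (fun t => [ffun j => if j == i then ord_pred (t j) else t j]) => t;
  apply/ffunP => j; rewrite !ffunE; case: eqP => // _.
  exact: ordSK.
exact: ord_predK.
Qed.

Lemma next_indexE i t : exists z : int, forall j,
  (next_index i t j)%:R = (t j)%:R + (j == i)%:R * (1 - N%:R * z%:~R) :> R.
Proof.
pose q := ((t i).+1 %/ N)%N; exists q%:Z => j; rewrite ffunE.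
case: eqP => [->|_]; last by rewrite mul0r addr0.
have : (t i).+1%:R = q%:R * N%:R + ((t i).+1 %% N)%:R :> R.
  by rewrite -natrM -natrD -divn_eq.
by rewrite -(natr1 (t i)) /= -[q%:Z%:~R]/(q%:R) mul1r; lra.
Qed.

(** On the torus, taking the successor is the translation by [1 / N] in the [i]-th
    direction; [m] accounts for the wrap-around. *)
Lemma grid_next_index i t : exists m : 'cV[int]_p,
  grid (next_index i t) = grid t + N%:R^-1 *: delta_mx i 0 + intmx R m.
Proof.
have [z zE] := next_indexE i t; exists (\col_j ((j == i)%:Z * - z)).
apply/colP => j; rewrite !mxE zE eqxx andbT rmorphM rmorphN /=.
by case: (j == i); rewrite ?mul0r ?mulr0 /=; field.
Qed.

Lemma sum_grid_shift i (g : 'cV[R]_p -> R) : Zn_periodic g ->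
  \sum_t g (grid t + N%:R^-1 *: delta_mx i 0) = \sum_t g (grid t).
Proof.
move=> pg; rewrite -(sum_next_index i (fun t => g (grid t))); apply: eq_bigr => t _.
by have [m ->] := grid_next_index i t; rewrite pg.
Qed.

Lemma cosB_half (A d : R) : cos (A - d) - cos A = 2 * sin (d / 2) * sin (A - d / 2).
Proof.
have E1 : A - d = (A - d / 2) - d / 2 by field.
have E2 : cos A = cos ((A - d / 2) + d / 2) by congr cos; field.
by rewrite E1 E2 (cosB (A - d / 2)) (cosD (A - d / 2)); ring.
Qed.

(** Orthogonality of the characters of the grid. Passing to the next frequency in a
    direction [i] where [u] and [t] differ adds the same angle [d] to every phase and
    permutes the terms. So the sum of [cos (phase + s)] is unchanged when [s] becomes
    [s + d]; comparing the two at [s = pi / 2 - d / 2] gives [2 sin (d / 2)] times the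
    wanted sum, and [sin (d / 2)] is nonzero because [0 < |u i - t i| < N]. *)
Lemma sum_freq_cos_eq0 (u t : {ffun 'I_p -> 'I_N}) : u != t ->
  \sum_(w : {ffun 'I_p -> 'I_N}) cos (angle (freq w) (grid u - grid t)) = 0.
Proof.
move=> ut; have [i uti] : exists i, u i != t i.
  apply/existsP; rewrite -negb_forall; apply: contra ut => /forallP ut.
  by apply/eqP/ffunP => i; apply/eqP.
set D := grid u - grid t; pose d := 2 * pi * D i 0.
have inv s : \sum_(w : {ffun 'I_p -> 'I_N}) cos (angle (freq w) D + s + d) =
    \sum_(w : {ffun 'I_p -> 'I_N}) cos (angle (freq w) D + s).
  rewrite -(sum_next_index i (fun w => cos (angle (freq w) D + s))); apply: eq_bigr => w _.
  have [z zE] := next_indexE i w.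
  have -> : angle (freq (next_index i w)) D =
      angle (freq w) D + d - 2 * pi * (z * ((u i)%:Z - (t i)%:Z))%:~R.
    rewrite /angle (bigD1 i)//= [in RHS](bigD1 i)//= !mxE !rmorphM !rmorphD !rmorphN /=.
    rewrite -!pmulrn zE eqxx mul1r (eq_bigr (fun j => (freq w j 0)%:~R * D j 0)); last first.
      by move=> j /negPf ji; rewrite !mxE !rmorphD !rmorphN /= -!pmulrn zE ji mul0r addr0.
    by rewrite /d !mxE; field.
  move: (z * _) => m; rewrite -(cosD2pi_int _ (- m)) rmorphN /=.
  by congr cos; ring.
have dE : d / 2 = pi * (((u i)%:R - (t i)%:R) / N%:R).
  by rewrite /d !mxE; field.
have sd : sin (d / 2) != 0.
  have P (x y : 'I_N) : (x < y)%N -> sin (pi * ((y%:R - x%:R) / N%:R)) != 0 :> R.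
    move=> xy; apply: lt0r_neq0; apply: sin_gt0_pi.
    have N_gt0 : 0 < N%:R :> R by rewrite ltr0n.
    have yx : x%:R < y%:R :> R by rewrite ltr_nat.
    have yN : y%:R < N%:R :> R by rewrite ltr_nat.
    have x0 : 0 <= x%:R :> R by [].
    rewrite mulr_gt0 ?pi_gt0 ?divr_gt0 ?subr_gt0//=.
    by rewrite gtr_pMr ?pi_gt0// ltr_pdivrMr// mul1r; lra.
  move: uti; rewrite dE neq_ltn => /orP[/P|/P //].
  by rewrite -(opprB (t i)%:R) mulNr mulrN sinN oppr_eq0.
have E w : cos (angle (freq w) D + (pi / 2 - d / 2) + d) -
    cos (angle (freq w) D + (pi / 2 - d / 2)) =
    - (2 * sin (d / 2)) * cos (angle (freq w) D).
  have -> : angle (freq w) D + (pi / 2 - d / 2) + d =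
    (angle (freq w) D + d / 2) + pi / 2 by field.
  have -> : angle (freq w) D + (pi / 2 - d / 2) =
    (angle (freq w) D - d / 2) + pi / 2 by field.
  by rewrite !cosDpihalf sinD sinB; ring.
have /eqP := inv (pi / 2 - d / 2); rewrite -subr_eq0 -sumrB.
under eq_bigr do rewrite E.
by rewrite -mulr_sumr mulf_eq0 oppr_eq0 mulf_eq0 pnatr_eq0 (negPf sd) => /eqP.
Qed.

End Grid.
End DiscreteFourier.

(** * Rapid decrease of the discrete Fourier coefficients *)

Section FourierCoefficients.
Variables (R : realType) (p : nat).
Implicit Types (f g : 'cV[R]_p -> R) (i : 'I_p).

Definition iter_derive i M f : 'cV[R]_p -> R :=
  iter M (fun g x => 'D_(delta_mx i 0) g x) f.

Lemma smooth_iter_derive i M f : smooth f -> smooth (iter_derive i M f).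
Proof. by move=> sf; elim: M => //= M IH; apply: smooth_derive. Qed.

Lemma periodic_derive f v : Zn_periodic f -> Zn_periodic (fun x => 'D_v f x).
Proof.
move=> pf x k; transitivity ('D_v (fun y => f (y + intmx R k)) x).
  by rewrite derive_shift_arg.
by rewrite (_ : (fun y => f (y + intmx R k)) = f)//; apply/funext => y; rewrite pf.
Qed.

Lemma periodic_iter_derive i M f : Zn_periodic f -> Zn_periodic (iter_derive i M f).
Proof. by move=> pf; elim: M => //= M IH; apply: periodic_derive. Qed.

Lemma smooth_increment f a : smooth f -> smooth (fun x => f (x + a) - f x).
Proof.
move=> sf; apply: smooth_add; first exact: smooth_shift.
under eq_fun do rewrite -scaleN1r.
exact: smooth_scale.
Qed.

Lemma iter_derive_increment i M f a : smooth f ->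
  iter_derive i M (fun x => f (x + a) - f x) =
  (fun x => iter_derive i M f (x + a) - iter_derive i M f x).
Proof.
move=> sf; elim: M => // M IH; rewrite /iter_derive /= -!/(iter_derive i M _) IH.
apply/funext => x; have sM := smooth_iter_derive i M sf.
rewrite deriveB ?derive_shift_arg//; last exact: smooth_derivable.
by apply: smooth_derivable; apply: smooth_shift.
Qed.

(** Summation by parts on the grid. Replacing [f] by its increment over one step in
    direction [i] multiplies the sum by [2 sin (pi k_i / N)] and shifts the phase [s],
    while it divides the bound by [N]; the statement is uniform in [s] so that the
    shift is harmless in the induction on [M]. *)
Lemma sum_grid_cos_le (N : nat) (k : 'cV[int]_p) i M f (K s : R) : (0 < N)%N ->
  smooth f -> Zn_periodic f -> (forall x, `|iter_derive i M f x| <= K) ->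
  `|\sum_(t : {ffun 'I_p -> 'I_N}) f (grid R t) * cos (angle k (grid R t) + s)| *
    (2 * `|sin (pi * ((k i 0)%:~R / N%:R))|) ^+ M <= N%:R ^+ p * (K / N%:R ^+ M).
Proof.
move=> N0; elim: M f K s => [|M IH] f K s sf pf fK.
  rewrite !expr0 mulr1 divr1; apply: le_trans (ler_norm_sum _ _ _) _.
  apply: (@le_trans _ _ (\sum_(t : {ffun 'I_p -> 'I_N}) K)).
    by apply: ler_sum => t _; rewrite normrM -[K]mulr1 ler_pM ?cos_max.
  by rewrite sumr_const card_ffun !card_ord -[leLHS]mulr_natl natrX.
have N_gt0 : 0 < N%:R :> R by rewrite ltr0n.
pose e := N%:R^-1 *: delta_mx i 0 : 'cV[R]_p; pose d := 2 * (pi * ((k i 0)%:~R / N%:R)) : R.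
have de : angle k e = d.
  rewrite /angle (bigD1 i)//= big1 ?addr0 => [|j /negPf ji].
    by rewrite !mxE !eqxx /= /d; field; rewrite lt0r_neq0.
  by rewrite !mxE ji mulr0 mulr0.
pose Df x := f (x + e) - f x.
have pDf : Zn_periodic Df by move=> x m; rewrite /Df addrAC !pf.
have DfK x : `|iter_derive i M Df x| <= K / N%:R.
  rewrite iter_derive_increment//.
  have := @le_derive_increment R _ (iter_derive i M f) K N%:R^-1 x (delta_mx i 0).
  by rewrite mulrC; apply => //; exact: smooth_iter_derive.
have := IH Df (K / N%:R) (s + d / 2 + pi / 2) (smooth_increment e sf) pDf DfK.
have -> : \sum_(t : {ffun 'I_p -> 'I_N})
      Df (grid R t) * cos (angle k (grid R t) + (s + d / 2 + pi / 2)) =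
    2 * sin (d / 2) * \sum_(t : {ffun 'I_p -> 'I_N})
      f (grid R t) * cos (angle k (grid R t) + s).
  (* the summand containing f (x + e), seen as a function of x + e *)
  pose g x := f x * cos (angle k x + (s + d / 2 + pi / 2) - d).
  have pg : Zn_periodic g.
    move=> x m; rewrite /g pf angleD angle_int; congr (_ * _).
    rewrite -[in RHS](cosD2pi_int _ (\sum_j k j 0 * m j 0)); congr cos; ring.
  under eq_bigr do rewrite /Df mulrBl.
  rewrite sumrB; have := sum_grid_shift N0 i pg; rewrite -/e /g.
  under eq_bigr => t _.
    rewrite angleD de.
    have -> : angle k (grid R t) + d + (s + d / 2 + pi / 2) - d =
      angle k (grid R t) + (s + d / 2 + pi / 2) by ring.
    over.
  move=> ->; rewrite -sumrB mulr_sumr; apply: eq_bigr => t _.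
  rewrite -mulrBr cosB_half.
  have -> : angle k (grid R t) + (s + d / 2 + pi / 2) - d / 2 =
    angle k (grid R t) + s + pi / 2 by field.
  by rewrite sinDpihalf; ring.
have -> : d / 2 = pi * ((k i 0)%:~R / N%:R) by rewrite /d; field; rewrite lt0r_neq0.
rewrite normrM normrM (ger0_norm (ler0n R 2)) exprS => H.
rewrite mulrCA mulrA; apply: le_trans H _.
by rewrite exprS invfM !mulrA.
Qed.

(** The sup norm of an integer vector is attained at some coordinate; summation by
    parts is done in that direction. *)
Lemma weight_le_coord (k : 'cV[int]_p) :
  k = 0 \/ exists i, weight R k <= 2 * `|(k i 0)%:~R| /\ k i 0 != 0.
Proof.
have [->|k0] := eqVneq k 0; [by left|right].
have nk : `|intmx R k| != 0.
  rewrite normr_eq0; apply: contra k0 => /eqP/colP k0.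
  by apply/eqP/colP => i; have := k0 i; rewrite !mxE => /eqP; rewrite intr_eq0 => /eqP.
have [[i j]] := @mx_norm_neq0 _ _ _ (intmx R k) nk.
rewrite /= ord1 mxE => E; have E' : `|intmx R k| = `|(k i 0)%:~R| by exact: E.
exists i; rewrite /weight E'; have k1 : k i 0 != 0.
  by move: nk; rewrite E' normr_eq0 intr_eq0.
split=> //; have : 1 <= `|(k i 0)%:~R| :> R by rewrite -intr_norm -[1]/(1%:~R) ler_int; lia.
by lra.
Qed.

Lemma freq_half (N : nat) (t : {ffun 'I_p -> 'I_N}) i : (0 < N)%N ->
  `|(freq t i 0)%:~R / N%:R : R| <= 1 / 2.
Proof.
move=> N0; have N_gt0 : 0 < N%:R :> R by rewrite ltr0n.
rewrite normrM normfV (ger0_norm (ltW N_gt0)) ler_pdivrMr// -intr_norm.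
have : (2 * `|freq t i 0| <= N%:Z)%R.
  by rewrite mxE; have := ltn_ord (t i); lia.
by rewrite -(ler_int R) rmorphM /= => H; rewrite -pmulrn in H; lra.
Qed.

(** The phase [s] gives the cosine coefficient for [s = 0] and the sine coefficient
    for [s = - pi / 2]. *)
Definition fourier_coef (s : R) f : coef_family R p := fun n t =>
  (\sum_(u : {ffun 'I_p -> 'I_(2 ^ n)})
    f (grid R u) * cos (angle (freq t) (grid R u) + s)) / (2 ^ n)%:R ^+ p.

Lemma rapid_fourier_coef s f : smooth f -> Zn_periodic f -> rapid (fourier_coef s f).
Proof.
move=> sf pf M.
have [K0 f0] := periodic_bounded (smooth_continuous sf) pf.
have /boolp.choice [K fK] : forall i, exists K, forall x, `|iter_derive i M f x| <= K.
  move=> i; apply: periodic_bounded; last exact: periodic_iter_derive.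
  exact/smooth_continuous/smooth_iter_derive.
(* K0 serves the frequency zero; for the others, W below gives 4 ^+ M *)
exists (`|K0| + \sum_i 4 ^+ M * `|K i|) => n t.
have N0 : (0 < 2 ^ n)%N by rewrite expn_gt0.
set N := (2 ^ n)%N in t N0 *; have N_gt0 : 0 < N%:R :> R by rewrite ltr0n.
have S0 : 0 <= \sum_i 4 ^+ M * `|K i|.
  by apply: sumr_ge0 => i _; rewrite mulr_ge0 ?exprn_ge0.
rewrite /fourier_coef -/N normrM normfV [`|_ ^+ p|]ger0_norm ?exprn_ge0 ?(ltW N_gt0)//.
set S := `|\sum_u _|; have [k0|[i [wi ki]]] := weight_le_coord (freq t).
  rewrite k0 /weight (_ : intmx R 0 = 0) ?normr0 ?addr0 ?expr1n ?mulr1; last first.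
    by apply/matrixP => ? ?; rewrite !mxE.
  apply: (@le_trans _ _ `|K0|); last by rewrite lerDl.
  rewrite ler_pdivrMr ?exprn_gt0// /S.
  apply: le_trans (ler_norm_sum _ _ _) _.
  apply: (@le_trans _ _ (\sum_(u : {ffun 'I_p -> 'I_N}) `|K0|)).
    apply: ler_sum => u _; rewrite normrM -[`|K0|]mulr1 ler_pM ?cos_max//.
    exact: le_trans (f0 _) (ler_norm _).
  by rewrite sumr_const card_ffun !card_ord -[leLHS]mulr_natr natrX.
apply: (@le_trans _ _ (4 ^+ M * `|K i|)); last first.
  rewrite (bigD1 i)//= addrCA lerDl addr_ge0//.
  by apply: sumr_ge0 => j _; rewrite mulr_ge0 ?exprn_ge0.
have := @sum_grid_cos_le N (freq t) i M f `|K i| s N0 sf pf.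
move=> /(_ (fun x => le_trans (fK i x) (ler_norm _))); rewrite -/S => H.
have L := norm_sin_pi_ge (freq_half t i N0).
rewrite normrM normfV (ger0_norm (ltW N_gt0)) in L.
set c := 2 * _ in H.
have W : weight R (freq t) <= 4 * N%:R * c.
  apply: le_trans wi _; have -> : 2 * `|(freq t i 0)%:~R| =
    8 * N%:R * (`|(freq t i 0)%:~R| / N%:R / 4) :> R by field; rewrite lt0r_neq0.
  apply: le_trans (ler_wpM2l _ L) _; first by rewrite mulr_ge0 ?(ltW N_gt0).
  by rewrite /c; lra.
have WM : weight R (freq t) ^+ M <= (4 * N%:R * c) ^+ M.
  by rewrite lerXn2r ?nnegrE ?(ltW (weight_gt0 _ _))// (le_trans _ W)// ltW// weight_gt0.
rewrite mulrAC ler_pdivrMr ?exprn_gt0//.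
apply: le_trans (ler_wpM2l (normr_ge0 _) WM) _.
rewrite (exprMn M (4 * _)) (exprMn M 4) mulrCA; have -> : 4 ^+ M * `|K i| * N%:R ^+ p =
    4 ^+ M * N%:R ^+ M * (N%:R ^+ p * (`|K i| / N%:R ^+ M)).
  by field; rewrite expf_neq0 ?lt0r_neq0.
by rewrite ler_wpM2l// mulr_ge0 ?exprn_ge0 ?(ltW N_gt0).
Qed.

End FourierCoefficients.

(** * Convergence of the interpolating trigonometric polynomials *)

Section FourierInversion.
Variables (R : realType) (p : nat).
Implicit Types (f : 'cV[R]_p -> R).

Lemma angleB (k : 'cV[int]_p) (x y : 'cV[R]_p) : angle k (x - y) = angle k x - angle k y.
Proof. by rewrite -scaleN1r angleD angleZ mulN1r. Qed.

Definition fourier_cos f := fourier_coef 0 f.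
Definition fourier_sin f := fourier_coef (- (pi / 2)) f.

Lemma trig_fourierE f n x : trig (fourier_cos f) (fourier_sin f) n x =
  (\sum_(u : {ffun 'I_p -> 'I_(2 ^ n)}) f (grid R u) *
    \sum_(t : {ffun 'I_p -> 'I_(2 ^ n)}) cos (angle (freq t) (x - grid R u)))
  / (2 ^ n)%:R ^+ p.
Proof.
under eq_bigr do rewrite mulr_sumr.
rewrite exchange_big /= mulr_suml; apply: eq_bigr => t _.
rewrite /fourier_cos /fourier_sin /fourier_coef [LHS](_ : _ =
  ((\sum_(u : {ffun 'I_p -> 'I_(2 ^ n)})
      f (grid R u) * cos (angle (freq t) (grid R u) + 0)) * cos (angle (freq t) x) +
   (\sum_(u : {ffun 'I_p -> 'I_(2 ^ n)})
      f (grid R u) * cos (angle (freq t) (grid R u) - pi / 2)) * sin (angle (freq t) x))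
  / (2 ^ n)%:R ^+ p); last by field; rewrite expf_neq0// pnatr_eq0 expn_eq0.
congr (_ / _); rewrite !mulr_suml -big_split /=; apply: eq_bigr => u _.
by rewrite addr0 cosBpihalf angleB cosB; ring.
Qed.

Lemma trig_interpolation f n (u : {ffun 'I_p -> 'I_(2 ^ n)}) :
  trig (fourier_cos f) (fourier_sin f) n (grid R u) = f (grid R u).
Proof.
rewrite trig_fourierE (bigD1 u)//= [X in _ + X]big1 => [|v vu]; last first.
  by rewrite (@sum_freq_cos_eq0 R p (2 ^ n)%N) ?mulr0 ?expn_gt0// eq_sym.
rewrite (eq_bigr (fun=> 1)) => [|t _]; last first.
  rewrite subrr -(scale0r (0 : 'cV[R]_p)) angleZ mul0r cos0 //.
by rewrite sumr_const card_ffun !card_ord addr0 -natrX mulfK.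
Qed.

Lemma grid_near (N : nat) (x : 'cV[R]_p) : (0 < N)%N ->
  exists (u : {ffun 'I_p -> 'I_N}) (m : 'cV[int]_p),
    `|x - (grid R u + intmx R m)| <= N%:R^-1.
Proof.
move=> N0; have N_gt0 : 0 < N%:R :> R by rewrite ltr0n.
have H i : exists um : 'I_N * int, `|x i 0 - (um.1%:R / N%:R + um.2%:~R)| <= N%:R^-1.
  pose q := Num.floor (N%:R * x i 0).
  have NZ : (N%:Z != 0)%R by rewrite lt0r_neq0.
  have := ltz_mod q NZ; have := modz_ge0 q NZ; have := divz_eq q N%:Z.
  move: (q %/ N%:Z)%Z => z; case: (q %% N%:Z)%Z => // r qE _ rN.
  exists (Ordinal (rN : (r < N)%N), z) => /=.
  have := floor_itv (N%:R * x i 0); rewrite -/q qE !rmorphD rmorphM /= -!pmulrn.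
  move=> /andP[l1 l2].
  rewrite [X in `|X|](_ : _ =
    (N%:R * x i 0 - (z%:~R * N%:R + r%:R)) / N%:R); last by field; rewrite lt0r_neq0.
  rewrite normrM normfV (ger0_norm (ltW N_gt0)) ler_piMl ?invr_ge0 ?(ltW N_gt0)//.
  by rewrite ler_norml; apply/andP; split; lra.
have [um umP] := boolp.choice H.
exists [ffun i => (um i).1], (\col_i (um i).2).
rewrite [leLHS]/Num.Def.normr/= mx_normrE bigmax_le ?invr_ge0 ?(ltW N_gt0)//.
by move=> [i j] _; rewrite !mxE ffunE ord1 umP.
Qed.

(** Both [f] and its interpolation are continuous, the latter with a Lipschitz
    constant independent of [n], and they agree at a point within [2 ^ - n] of [x]. *)
Lemma trig_fourier_cvg f x : smooth f -> Zn_periodic f ->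
  trig (fourier_cos f) (fourier_sin f) n x @[n --> \oo] --> f x.
Proof.
move=> sf pf; have ra := rapid_fourier_coef 0 sf pf.
have rb := rapid_fourier_coef (- (pi / 2)) sf pf.
have [K K0 HK] := trig_lipschitz ra rb.
apply/cvgrPdist_le => e e0.
have cf : {for x, continuous f} by exact: smooth_continuous.
have e2 : 0 < e / 2 by rewrite divr_gt0.
have [d /= d0 Hd] := (nbhs_ballP _ _).1 ((cvgrPdist_le _ _).1 cf (e / 2) e2).
(* d / 2 because the ball of radius d is open *)
pose r := Num.min (d / 2) (e / 2 / (K + 1)).
have r0 : 0 < r by rewrite lt_min !divr_gt0// ltr_pwDr.
near=> n.
have N0 : (0 < 2 ^ n)%N by rewrite expn_gt0.
have Nr : (2 ^ n)%:R^-1 <= r.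
  apply: (@le_trans _ _ n.+1%:R^-1).
    by rewrite lef_pV2 ?posrE ?ltr0n// ler_nat ltn_expl.
  by apply: ltW; near: n; exact: (near_infty_natSinv_lt (PosNum r0)).
have [u [m um]] := grid_near x N0.
set y := grid R u + intmx R m in um.
have fy : f y = trig (fourier_cos f) (fourier_sin f) n y.
  by rewrite /y pf trig_periodic trig_interpolation.
have yr := le_trans um Nr.
rewrite -(subrKA (f y)); apply: le_trans (ler_normD _ _) _.
rewrite (splitr e) lerD//.
  apply: Hd; rewrite -ball_normE /=; apply: le_lt_trans yr _.
  by rewrite gt_min; apply/orP; left; lra.
rewrite fy distrC -[x](subrK y) [_ + y]addrC; apply: le_trans (HK _ _ _) _.
have : `|x - y| <= e / 2 / (K + 1).
  by apply: le_trans yr _; rewrite ge_min lexx orbT.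
rewrite ler_pdivlMr ?ltr_pwDr// => ?; have := normr_ge0 (x - y); nra.
Unshelve. all: by end_near. Qed.

End FourierInversion.

(** * The scalar cohomological equation *)

Section ScalarEquation.
Variables (R : realType) (p : nat).
Implicit Types (alpha : 'cV[R]_p).

Lemma small_divisor_bound alpha : diophantine alpha ->
  exists (K : R) (L : nat), 0 <= K /\ forall k : 'cV[int]_p, k != 0 ->
    sin (angle k alpha / 2) != 0 /\
    (2 * `|sin (angle k alpha / 2)|)^-1 <= K * weight R k ^+ L.
Proof.
(* an integer exponent above r *)
move=> [r [c [r0 c0 H]]]; exists (4 / c), (Num.truncn r).+1.
split=> [|k k0]; first by rewrite divr_ge0 ?(ltW c0).
set q := \sum_i (k i 0)%:~R * alpha i 0.
have -> : angle k alpha / 2 = pi * q by rewrite /angle -/q; field.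
have [k1|[i [wi ki]]] := weight_le_coord R k; first by rewrite k1 eqxx in k0.
have n1 : 1 <= `|intmx R k|.
  apply: le_trans (ler_norm_coord _ i 0); rewrite mxE -intr_norm.
  by rewrite -[1]/(1%:~R) ler_int; lia.
set L := (Num.truncn r).+1.
have wL : `|intmx R k| `^ r <= weight R k ^+ L.
  apply: (@le_trans _ _ (`|intmx R k| `^ L%:R)).
    by apply: ler_powR => //; rewrite /L; apply/ltW/truncnS_gt.
  by rewrite powR_mulrn// lerXn2r ?nnegrE// ?lerDr// ltW// weight_gt0.
have S : c / 4 <= `|sin (pi * q)| * weight R k ^+ L.
  have : c * `|intmx R k| `^ (- r) <= 4 * `|sin (pi * q)|.
    by apply: le_trans (H k k0) _; have := norm_sin_pi_ge_dist_int q; rewrite -/q; lra.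
  rewrite powRN; set n := _ `^ r in wL *.
  have ngt : 0 < n by rewrite powR_gt0// (lt_le_trans ltr01).
  rewrite ler_pdivrMr// => S.
  have := ler_wpM2l (normr_ge0 (sin (pi * q))) wL; lra.
have wgt : 0 < weight R k ^+ L by rewrite exprn_gt0// weight_gt0.
have sgt : 0 < `|sin (pi * q)|.
  rewrite lt_def normr_ge0 andbT; apply: contraTneq S => ->.
  by rewrite mul0r -ltNge divr_gt0.
split; first by rewrite -normr_gt0.
rewrite -[leLHS]mul1r ler_pdivrMr ?mulr_gt0//.
rewrite ler_pdivrMr// in S.
have -> : 4 / c * weight R k ^+ L * (2 * `|sin (pi * q)|) =
  2 * (`|sin (pi * q)| * weight R k ^+ L * 4) / c by field; rewrite lt0r_neq0.
by rewrite ler_pdivlMr// mul1r; lra.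
Qed.

(** Coefficients of the solution [w] of
    [w (x + alpha) - w x = a cos (angle k x) + b sin (angle k x)] for a single
    frequency [k]. With [d = angle k alpha / 2] they come from
    [sin (y + d) - sin (y - d) = 2 sin d cos y] at [y = angle k x], that is
    [w x = (a sin (y - d) - b cos (y - d)) / (2 sin d)]. The frequency zero has no
    solution and is left out. *)
Definition solve_cos alpha (a b : coef_family R p) : coef_family R p := fun n t =>
  let d := angle (freq t) alpha / 2 in
  if freq t == 0 then 0 else (- (a n t * sin d) - b n t * cos d) * (2 * sin d)^-1.
Definition solve_sin alpha (a b : coef_family R p) : coef_family R p := fun n t =>
  let d := angle (freq t) alpha / 2 in
  if freq t == 0 then 0 else (a n t * cos d - b n t * sin d) * (2 * sin d)^-1.

Lemma solve_trigE alpha a b n (x : 'cV[R]_p) :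
  (forall k : 'cV[int]_p, k != 0 -> sin (angle k alpha / 2) != 0) ->
  trig (solve_cos alpha a b) (solve_sin alpha a b) n (x + alpha) -
  trig (solve_cos alpha a b) (solve_sin alpha a b) n x =
  trig a b n x - \sum_(t : {ffun 'I_p -> 'I_(2 ^ n)} | freq t == 0) a n t.
Proof.
move=> sn0; rewrite /trig -sumrB [X in _ - X]big_mkcond -sumrB /=.
apply: eq_bigr => t _; rewrite /solve_cos /solve_sin angleD.
case: eqVneq => [t0|t0].
  have a0 z : angle 0 z = 0 :> R by rewrite /angle big1 ?mulr0// => i _; rewrite mxE mul0r.
  by rewrite t0 !a0 cos0 sin0; ring.
have := sn0 _ t0; set d := angle _ alpha / 2 => d0.
have -> : angle (freq t) alpha = d + d by rewrite /d; field.
(* u is the middle of the phases at x and at x + alpha *)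
have [u ->] : exists u, angle (freq t) x = u - d by exists (angle (freq t) x + d); ring.
have -> : u - d + (d + d) = u + d by ring.
by rewrite subr0 !sinB !cosB !sinD !cosD; field.
Qed.

Lemma rapid_add_norm (a b : coef_family R p) : rapid a -> rapid b ->
  rapid (fun n t => `|a n t| + `|b n t|).
Proof.
move=> ra rb M; have [C1 H1] := ra M; have [C2 H2] := rb M.
by exists (C1 + C2) => n t; rewrite ger0_norm ?addr_ge0// mulrDl lerD.
Qed.

Lemma rapid_solve alpha (a b : coef_family R p) : diophantine alpha -> rapid a -> rapid b ->
  rapid (solve_cos alpha a b) /\ rapid (solve_sin alpha a b).
Proof.
move=> /small_divisor_bound [K [L [K0 H]]] ra rb.
have le_pq (x y s c d w : R) : `|s| <= 1 -> `|c| <= 1 -> (2 * `|d|)^-1 <= K * w ->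
    `|(x * s - y * c) * (2 * d)^-1| <= K * w * (`|x| + `|y|).
  move=> s1 c1 dw; rewrite normrM normfV normrM (ger0_norm (ler0n R 2)) mulrC.
  apply: ler_pM => //; rewrite ?invr_ge0 ?mulr_ge0//.
  apply: le_trans (ler_normB _ _) _; rewrite !normrM lerD//.
    by rewrite ler_piMr.
  by rewrite ler_piMr.
split; apply: (@rapid_mul_poly _ _ _ _ K L (rapid_add_norm ra rb)) => n t.
  rewrite /solve_cos; case: eqVneq => [_|t0].
    by rewrite normr0 !mulr_ge0 ?exprn_ge0 ?(ltW (weight_gt0 _ _)).
  rewrite [`|_ + _|]ger0_norm ?addr_ge0// -mulNr -[`|a n t|]normrN.
  by apply: le_pq; rewrite ?sin_max ?cos_max//; exact: (H _ t0).2.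
rewrite /solve_sin; case: eqVneq => [_|t0].
  by rewrite normr0 !mulr_ge0 ?exprn_ge0 ?(ltW (weight_gt0 _ _)).
rewrite [`|_ + _|]ger0_norm ?addr_ge0//.
by apply: le_pq; rewrite ?sin_max ?cos_max//; exact: (H _ t0).2.
Qed.

(** At level [n] the equation holds up to the coefficients of frequency zero. Their sum
    does not depend on [x] and, by the equation itself, it converges; its limit is
    [b]. *)
Theorem cohomological_equation alpha (f : 'cV[R]_p -> R) :
  diophantine alpha -> smooth f -> Zn_periodic f ->
  exists (b : R) (w : 'cV[R]_p -> R), [/\ smooth w, Zn_periodic w &
    forall x, f x = b + (w (x + alpha) - w x)].
Proof.
move=> da sf pf.
have [G [UG hG]] := @ultraFilterLemma nat \oo _.
have ra : rapid (fourier_cos f) by exact: rapid_fourier_coef.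
have rb : rapid (fourier_sin f) by exact: rapid_fourier_coef.
have [rc rs] := rapid_solve da ra rb.
set c := solve_cos _ _ _ in rc; set s := solve_sin _ _ _ in rs.
pose w := trig_lim G c s.
pose b n := \sum_(t : {ffun 'I_p -> 'I_(2 ^ n)} | freq t == 0) fourier_cos f t.
have [K [L [_ HKL]]] := small_divisor_bound da.
have bE x n : b n = trig (fourier_cos f) (fourier_sin f) n x -
    (trig c s n (x + alpha) - trig c s n x).
  by rewrite solve_trigE ?subKr// => k k0; have [] := HKL k k0.
have cb x : b n @[n --> G] --> f x - (w (x + alpha) - w x).
  under eq_fun do rewrite (bE x).
  apply: cvgB; first by move=> A /(trig_fourier_cvg sf pf) /hG.
  by apply: cvgB; exact: trig_lim_cvg.
exists (lim (b n @[n --> G])), w; split.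
- exact: smooth_trig_lim.
- exact: trig_lim_periodic.
- by move=> x; rewrite (cvg_lim _ (cb x))// subrK.
Qed.

End ScalarEquation.

(** * Quasi-unipotent integer matrices *)

Lemma dvdp_prod_unity_root (K : fieldType) (rs : seq K) (m : nat) :
  (forall r, r \in rs -> r ^+ m = 1) ->
  \prod_(r <- rs) ('X - r%:P) %| ('X^m - 1) ^+ size rs.
Proof.
elim: rs => [|r s IH] mP; first by rewrite big_nil dvd1p.
rewrite big_cons exprS; apply: dvdp_mul.
  by rewrite dvdp_XsubCl rootE !hornerE mP ?inE ?eqxx// subrr.
by apply: IH => z zs; apply: mP; rewrite inE zs orbT.
Qed.

Section QuasiUnipotent.
Variable R : realType.

Lemma eigenvalue_linear_part p q (B : 'M[int]_q) (C : 'M[int]_(q, p)) (a : R[i]) :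
  complex_eigenvalue B a -> a = 1 \/ complex_eigenvalue (linear_part B C) a.
Proof.
move=> /eigenvalueP[v vB v0]; have [->|a1] := eqVneq a 1; [by left|right].
apply/eigenvalueP; exists (row_mx ((a - 1)^-1 *: (v *m map_mx intr C)) v).
  rewrite /linear_part map_block_mx map_mx1 map_mx0 mul_row_block mulmx1 mulmx0 add0r vB.
  rewrite scale_row_mx; congr row_mx; set w := _ *m _.
  rewrite -{2}[a](subrK 1) scalerDl scale1r scalerA mulfV ?subr_eq0// scale1r.
  exact: addrC.
by rewrite -row_mx0; apply: contra v0 => /eqP/eq_row_mx[_ ->].
Qed.

Lemma one_eigenvalue_linear_part p q (B : 'M[int]_q) (C : 'M[int]_(q, p)) :
  (0 < p)%N -> complex_eigenvalue (linear_part B C) (1 : R[i]).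
Proof.
case: p C => // p C _; apply/eigenvalueP; exists (row_mx (delta_mx 0 0) 0).
  rewrite /linear_part map_block_mx map_mx1 map_mx0 mul_row_block.
  by rewrite mulmx1 mulmx0 !mul0mx !addr0 scale1r.
apply/eqP => /rowP/(_ (lshift q 0)).
by rewrite row_mxEl !mxE eqxx => /eqP; rewrite oner_eq0.
Qed.

(** Take for [m] a common multiple of the orders of the eigenvalues. The characteristic polynomial,
    split over the complex numbers, divides a power of [X^m - 1], and Cayley-Hamilton
    applies. The conclusion descends to the integers, then goes to the reals. *)
Lemma quasi_unipotent_nilpotent n (A : 'M[int]_n) :
  quasi_unipotent R A ->
  exists m N, (0 < m)%N /\ ((intmx R A) ^+ m - 1) ^+ N = 0.
Proof.
case: n A => [|n] A qA; first by exists 1, 0; split=> //; apply/matrixP => -[].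
pose AC : 'M[R[i]]_n.+1 := map_mx intr A.
have [rs rsE] := closed_field_poly_normal (char_poly AC).
rewrite (monicP (char_poly_monic AC)) scale1r in rsE.
have [m m0 mP] : exists2 m, (0 < m)%N & forall r, r \in rs -> r ^+ m = 1.
  have : forall r, r \in rs -> exists2 k, (0 < k)%N & r ^+ k = 1.
    move=> r rrs; have [|k k0 /unity_rootP rk] := qA r; last by exists k.
    by rewrite /complex_eigenvalue eigenvalue_root_char rsE root_prod_XsubC.
  elim: (rs) => [|r s IH] H; first by exists 1.
  have [|m m0 mP] := IH; first by move=> z zs; apply: H; rewrite inE zs orbT.
  have [|k k0 kP] := H r; first by rewrite inE eqxx.
  exists (k * m)%N => [|z]; first by rewrite muln_gt0 k0.
  rewrite inE => /predU1P[->|zs]; first by rewrite exprM kP expr1n.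
  by rewrite mulnC exprM mP// expr1n.
have : char_poly AC %| ('X^m - 1) ^+ size rs.
  by rewrite rsE; apply: dvdp_prod_unity_root.
move=> /dvdpP[Q QE]; exists m, (size rs); split=> //.
have AC0 : (AC ^+ m - 1) ^+ size rs = 0.
  have := congr1 (horner_mx AC) QE.
  rewrite rmorphM /= Cayley_Hamilton mulr0 rmorphXn /= rmorphB rmorph1 /= rmorphXn /=.
  by rewrite horner_mx_X.
have Z0 : (A ^+ m - 1) ^+ size rs = 0.
  apply/matrixP => i j; move/matrixP: AC0 => /(_ i j); rewrite /AC.
  have -> : (map_mx intr A ^+ m - 1) ^+ size rs =
    map_mx intr ((A ^+ m - 1) ^+ size rs) :> 'M[R[i]]_n.+1.
    by rewrite rmorphXn rmorphB rmorph1 rmorphXn.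
  by rewrite !mxE => /eqP; rewrite intr_eq0 => /eqP.
by rewrite /intmx -rmorphXn /= -(rmorph1 (map_mx intr)) -rmorphB -rmorphXn /= Z0 map_mx0.
Qed.

End QuasiUnipotent.

(** * The vector equation twisted by B *)

Section VectorEquation.
Variables (R : realType) (p : nat).
Implicit Types (alpha : 'cV[R]_p).

Lemma diophantine_mulrn alpha m : (0 < m)%N -> diophantine alpha -> diophantine (alpha *+ m).
Proof.
move=> m0 [r [c [r0 c0 H]]]; exists r, (c * m%:R `^ (- r)).
have mgt : 0 < m%:R :> R by rewrite ltr0n.
split=> // [|k k0]; first by rewrite mulr_gt0 ?powR_gt0.
have := H (k *+ m); rewrite -[k *+ m]scaler_nat scalemx_eq0 pnatr_eq0 negb_or -lt0n m0.
rewrite scaler_nat => /(_ k0).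
have -> : intmx R (k *+ m) = m%:R *: intmx R k.
  by rewrite /intmx -scaler_nat map_mxZ rmorph_nat.
rewrite normrZ (ger0_norm (ltW mgt)) powRM// mulrA.
by congr (_ <= dist_int _); apply: eq_bigr => i _; rewrite !mulmxnE rmorphMn /= mulrnAl mulrnAr.
Qed.

Lemma vector_cohomological_equation q alpha (F : 'cV[R]_p -> 'cV[R]_q) :
  diophantine alpha -> smooth F -> Zn_periodic F ->
  exists (b : 'cV[R]_q) (w : 'cV[R]_p -> 'cV[R]_q), [/\ smooth w, Zn_periodic w &
    forall x, F x = b + (w (x + alpha) - w x)].
Proof.
move=> da sF pF.
have H i : exists bw : R * ('cV[R]_p -> R), [/\ smooth bw.2, Zn_periodic bw.2 &
    forall x, F x i 0 = bw.1 + (bw.2 (x + alpha) - bw.2 x)].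
  have [||b [w wP]] := @cohomological_equation R p alpha (fun x => F x i 0) da.
  - exact: smooth_coord.
  - by move=> x k; rewrite pF.
  - by exists (b, w).
have [bw bwP] := boolp.choice H.
exists (\col_i (bw i).1), (fun x => \col_i (bw i).2 x); split.
- apply: smooth_mx => i j; under eq_fun do rewrite mxE.
  by have [] := bwP i.
- by move=> x k; apply/colP => i; rewrite !mxE; have [_ -> _] := bwP i.
- by move=> x; apply/colP => i; rewrite !mxE; have [_ _ ->] := bwP i.
Qed.

(** Solves the equation up to an error in the range of [E ^+ N]: each step solves the
    untwisted equation for the error and pushes it one power of [E] further. *)
Lemma nilpotent_equation q N alpha (E : 'M[R]_q) (F : 'cV[R]_p -> 'cV[R]_q) :
  diophantine alpha -> smooth F -> Zn_periodic F ->
  exists (b : 'cV[R]_q) (u w : 'cV[R]_p -> 'cV[R]_q),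
    [/\ smooth u, Zn_periodic u, smooth w, Zn_periodic w &
    forall x, F x = b + (u (x + alpha) - u x - E *m u x) + E ^+ N *m w x].
Proof.
move=> da sF pF; elim: N => [|N [b [u [w [su pu sw pw H]]]]].
  exists 0, (fun=> 0), F; split=> //; first exact: smooth_cst.
  by move=> x; rewrite expr0 mul1mx mulmx0 !subr0 !add0r.
have [b' [w' [sw' pw' H']]] := vector_cohomological_equation da sw pw.
exists (b + E ^+ N *m b'), (fun x => u x + E ^+ N *m w' x), w'; split=> //.
- by apply: smooth_add => //; apply: smooth_mulmx.
- by move=> x k; rewrite pu pw'.
move=> x; have ES y : E *m (E ^+ N *m y) = E ^+ N.+1 *m y :> 'cV_q.
  by rewrite exprS mulmxA.
rewrite H H' !(mulmxDr (E ^+ N)) mulmxN (mulmxDr E) ES.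
move: (E *m u x) (E ^+ N *m w' (x + alpha)) (E ^+ N *m w' x) (E ^+ N *m b') => ? ? ? ?.
by apply/colP => i; rewrite !mxE; ring.
Qed.

(** [v] is the sum of the [B ^+ (m - 1 - j) *m u (x + alpha *+ j)] for [j < m], that is
    [(S^m - B^m) / (S - B)] applied to [u], where [S] is the shift by [alpha]. *)
Lemma telescoped_solution q alpha (B : 'M[R]_q) m (u : 'cV[R]_p -> 'cV[R]_q) :
  smooth u -> Zn_periodic u -> exists v : 'cV[R]_p -> 'cV[R]_q,
    [/\ smooth v, Zn_periodic v & forall x,
      v (x + alpha) - B *m v x = u (x + alpha *+ m) - B ^+ m *m u x].
Proof.
move=> su pu; elim: m => [|m [v [sv pv H]]].
  exists (fun=> 0); split=> //; first exact: smooth_cst.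
  by move=> x; rewrite mulr0n addr0 expr0 mul1mx mulmx0 !subrr.
exists (fun x => u (x + alpha *+ m) + B *m v x); split.
- by apply: smooth_add; [apply: smooth_shift|apply: smooth_mulmx].
- by move=> x k; rewrite pv addrAC pu.
move=> x; have -> : x + alpha + alpha *+ m = x + alpha *+ m.+1 by rewrite mulrS addrA.
rewrite exprS -mulmxA -addrA -mulmxBr -mulmxN; congr (_ + B *m _).
have /eqP := H x; rewrite subr_eq => /eqP ->.
move: (B *m v x) (B ^+ m *m u x) => ? ?.
by apply/colP => i; rewrite !mxE; ring.
Qed.

Theorem twisted_cohomological_equation q m N alpha (B : 'M[R]_q)
    (F : 'cV[R]_p -> 'cV[R]_q) :
  (0 < m)%N -> (B ^+ m - 1) ^+ N = 0 ->
  diophantine alpha -> smooth F -> Zn_periodic F ->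
  exists (b : 'cV[R]_q) (u : 'cV[R]_p -> 'cV[R]_q), [/\ smooth u, Zn_periodic u &
    forall x, F x = b + (u (x + alpha) - B *m u x)].
Proof.
move=> m0 BN da sF pF.
have [b [u [w [su pu _ _ H]]]] :=
  nilpotent_equation N (B ^+ m - 1) (diophantine_mulrn m0 da) sF pF.
have [v [sv pv E]] := telescoped_solution alpha B m su pu.
exists b, v; split=> // x; rewrite E H BN mul0mx addr0 mulmxBl mul1mx.
by congr (b + _); rewrite opprB addrA subrK.
Qed.

End VectorEquation.

(** * Maps of tori and fibred translations *)

Section Torus.
Variable R : realType.

Lemma proj_torusP n (x y : 'cV[R]_n) :
  proj_torus x = proj_torus y <-> exists k : 'cV[int]_n, x = y + intmx R k.
Proof.
split=> [/(@eqmodP _ (Zn_equiv_rel R n) x y) /forallP xy|[k ->]].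
  exists (\col_i Num.floor (x i 0 - y i 0)); apply/colP => i; rewrite !mxE.
  by rewrite floorK ?xy// addrC subrK.
apply/(@eqmodP _ (Zn_equiv_rel R n) _ _)/forallP => i.
by rewrite !mxE addrAC subrr add0r intr_int.
Qed.

Lemma proj_torusK n (t : torus R n) : proj_torus (repr t) = t.
Proof. exact: reprK. Qed.

Lemma proj_torus_int n (x : 'cV[R]_n) k : proj_torus (x + intmx R k) = proj_torus x.
Proof. by apply/proj_torusP; exists k. Qed.

Lemma repr_proj_torus n (x : 'cV[R]_n) :
  exists k : 'cV[int]_n, repr (proj_torus x) = x + intmx R k.
Proof. by apply/proj_torusP; rewrite proj_torusK. Qed.

Lemma repr_periodic n (T : Type) (f : 'cV[R]_n -> T) x : Zn_periodic f ->
  f (repr (proj_torus x)) = f x.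
Proof. by move=> pf; have [k ->] := repr_proj_torus x. Qed.

Definition torus_map m n (f : 'cV[R]_m -> 'cV[R]_n) (t : torus R m) : torus R n :=
  proj_torus (f (repr t)).

Lemma torus_map_given_by m n (f : 'cV[R]_m -> 'cV[R]_n) :
  Zn_periodic (fun x => proj_torus (f x)) -> given_by (torus_map f) f.
Proof. by move=> pf x; rewrite /torus_map (repr_periodic x pf). Qed.

Lemma given_by_comp m n l (phi : torus R n -> torus R l) (psi : torus R m -> torus R n)
    f g : given_by phi f -> given_by psi g -> given_by (phi \o psi) (f \o g).
Proof. by move=> pf pg x; rewrite /= pg pf. Qed.

Lemma given_by_unique m n (phi psi : torus R m -> torus R n) f :
  given_by phi f -> given_by psi f -> phi = psi.
Proof. by move=> pf pg; apply/funext => t; rewrite -(proj_torusK t) pf pg. Qed.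

Lemma intmx_mul m n l (A : 'M[int]_(m, n)) (k : 'M[int]_(n, l)) :
  intmx R A *m intmx R k = intmx R (A *m k).
Proof. by rewrite /intmx map_mxM. Qed.

Lemma intmxD m n (A B : 'M[int]_(m, n)) : intmx R A + intmx R B = intmx R (A + B).
Proof. by rewrite /intmx map_mxD. Qed.

Lemma usubmx_intmx p q (k : 'cV[int]_(p + q)) : usubmx (intmx R k) = intmx R (usubmx k).
Proof. by rewrite /intmx map_usubmx. Qed.

Lemma dsubmx_intmx p q (k : 'cV[int]_(p + q)) : dsubmx (intmx R k) = intmx R (dsubmx k).
Proof. by rewrite /intmx map_dsubmx. Qed.

Section Shear.
Variables p q : nat.

Definition shear (w : 'cV[R]_p -> 'cV[R]_q) (z : 'cV[R]_(p + q)) : 'cV[R]_(p + q) :=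
  z - col_mx 0 (w (usubmx z)).

Lemma shear_usubmx w z : usubmx (shear w z) = usubmx z.
Proof. by rewrite /shear linearB /= col_mxKu subr0. Qed.

Lemma shear_dsubmx w z : dsubmx (shear w z) = dsubmx z - w (usubmx z).
Proof. by rewrite /shear linearB /= col_mxKd. Qed.

Lemma shearK w : cancel (shear w) (shear (fun x => - w x)).
Proof.
move=> z; rewrite {1}/shear shear_usubmx /shear !opp_col_mx oppr0 opprK.
by rewrite -addrA add_col_mx addr0 addNr col_mx0 addr0.
Qed.

Lemma shear_int w z k : Zn_periodic w -> shear w (z + intmx R k) = shear w z + intmx R k.
Proof. by move=> pw; rewrite /shear linearD /= usubmx_intmx pw addrAC. Qed.

Lemma smooth_shear w : smooth w -> smooth (shear w).
Proof.
move=> sw; rewrite (_ : shear w = fun z => z + col_mx 0 (- 1%:M) *m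
    w (row_mx 1%:M 0 *m z + 0)); last first.
  apply/funext => z; rewrite /shear opp_col_mx oppr0.
  have -> : row_mx 1%:M 0 *m z + 0 = usubmx z.
    by rewrite -{1}(vsubmxK z) mul_row_col mul1mx mul0mx !addr0.
  by rewrite mul_col_mx mul0mx mulNmx mul1mx.
apply: smooth_add; first exact: smooth_id.
by apply: smooth_mulmx; apply: smooth_comp_affine.
Qed.

Definition torus_shear w : torus R (p + q) -> torus R (p + q) := torus_map (shear w).

Lemma torus_shear_given_by w : Zn_periodic w -> given_by (torus_shear w) (shear w).
Proof.
move=> pw; apply: torus_map_given_by => x k.
by rewrite shear_int// proj_torus_int.
Qed.

Lemma torus_shearK w : Zn_periodic w ->
  cancel (torus_shear w) (torus_shear (fun x => - w x)).
Proof.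
move=> pw t; have pNw : Zn_periodic (fun x => - w x) by move=> x k; rewrite pw.
have := given_by_comp (torus_shear_given_by pNw) (torus_shear_given_by pw).
move=> /(_ (repr t)); rewrite /= shearK proj_torusK.
by [].
Qed.

Lemma torus_shear_diffeo w : smooth w -> Zn_periodic w -> torus_diffeo (torus_shear w).
Proof.
move=> sw pw.
have pNw : Zn_periodic (fun x => - w x) by move=> x k; rewrite pw.
have sNw : smooth (fun x => - w x).
  by under eq_fun do rewrite -scaleN1r; apply: smooth_scale.
split; first by exists (shear w); split; [exact: smooth_shear|exact: torus_shear_given_by].
exists (torus_shear (fun x => - w x)); split.
- by exists (shear (fun x => - w x)); split;
    [exact: smooth_shear|exact: torus_shear_given_by].
- exact: torus_shearK.
- have := torus_shearK pNw; rewrite (_ : (fun x => - - w x) = w)//.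
  by apply/funext => x; rewrite opprK.
Qed.

Lemma skew_lift_int alpha (B : 'M[int]_q) (C : 'M[int]_(q, p)) (F : 'cV[R]_p -> 'cV[R]_q)
    z k : Zn_periodic F ->
  skew_lift alpha B C F (z + intmx R k) =
  skew_lift alpha B C F z + intmx R (linear_part B C *m k).
Proof.
move=> pF; have U : usubmx (z + intmx R k) = usubmx z + intmx R (usubmx k).
  by rewrite linearD /= usubmx_intmx.
have D : dsubmx (z + intmx R k) = dsubmx z + intmx R (dsubmx k).
  by rewrite linearD /= dsubmx_intmx.
have -> : linear_part B C *m k = col_mx (usubmx k) (C *m usubmx k + B *m dsubmx k).
  by rewrite -{1}(vsubmxK k) mul_block_col mul1mx mul0mx addr0.
rewrite /skew_lift U D pF [intmx R (col_mx _ _)]/intmx map_col_mx add_col_mx.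
congr col_mx; first by rewrite addrAC.
rewrite !mulmxDr.
rewrite -/(intmx R _) -intmxD !intmx_mul.
move: (intmx R C *m _) (intmx R B *m _) (intmx R (C *m _)) (intmx R (B *m _)) (F _) => *.
by apply/colP => i; rewrite !mxE; ring.
Qed.

Lemma shear_skew_lift alpha (B : 'M[int]_q) (C : 'M[int]_(q, p))
    (F w : 'cV[R]_p -> 'cV[R]_q) b z :
  (forall x, F x = b + (w (x + alpha) - intmx R B *m w x)) ->
  shear w (skew_lift alpha B C F z) = skew_lift alpha B C (fun=> b) (shear w z).
Proof.
move=> H; rewrite {1}/shear /skew_lift col_mxKu shear_usubmx shear_dsubmx.
rewrite -[RHS]vsubmxK col_mxKu col_mxKd -[LHS]vsubmxK !linearB /= !col_mxKu !col_mxKd subr0.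
congr col_mx; rewrite H.
move: (intmx R C *m _) (intmx R B *m _) (intmx R B *m _) (w _) => *.
by apply/colP => i; rewrite !mxE; ring.
Qed.

Lemma skew_product_conjugate alpha (B : 'M[int]_q) (C : 'M[int]_(q, p))
    (F w : 'cV[R]_p -> 'cV[R]_q) b phi :
  (forall x, F x = b + (w (x + alpha) - intmx R B *m w x)) ->
  smooth w -> Zn_periodic w ->
  given_by phi (skew_lift alpha B C F) ->
  exists phi0, given_by phi0 (skew_lift alpha B C (fun=> b)) /\
    smoothly_conjugate phi phi0.
Proof.
move=> H sw pw gphi; have g0 : given_by (torus_map (skew_lift alpha B C (fun=> b)))
    (skew_lift alpha B C (fun=> b)).
  apply: torus_map_given_by => x k.
  by rewrite skew_lift_int// proj_torus_int.
exists (torus_map (skew_lift alpha B C (fun=> b))); split=> //.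
exists (torus_shear w); split; first exact: torus_shear_diffeo.
apply: given_by_unique (given_by_comp (torus_shear_given_by pw) gphi) _.
have := given_by_comp g0 (torus_shear_given_by pw).
by congr given_by; apply/funext => z; rewrite /= (shear_skew_lift _ _ H).
Qed.

End Shear.
End Torus.

(** * Integration against the Haar measure *)

Section HaarMean.
Variables (R : realType) (p : nat).
Implicit Types (f g : 'cV[R]_p -> R).

Lemma given_by_continuous m n (phi : torus R m -> torus R n)
    (f : 'cV[R]_m -> 'cV[R]_n) :
  given_by phi f -> continuous f -> continuous phi.
Proof.
move=> gf cf; apply/quotient_continuous.
rewrite (_ : _ \o _ = @proj_torus R n \o f); last by apply/funext => x; exact: gf.
move=> x; apply: continuous_comp; first exact: cf.
exact: pi_continuous.
Qed.

Lemma torus_add_given_by (s : torus R p) : given_by (torus_add s) (fun x => repr s + x).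
Proof.
move=> x; rewrite /torus_add; have [k ->] := repr_proj_torus x.
by rewrite addrA proj_torus_int.
Qed.

Lemma torus_add_opp (s t : torus R p) :
  torus_add (proj_torus (- repr s)) (torus_add s t) = t.
Proof.
rewrite -[t in RHS]proj_torusK {2}/torus_add torus_add_given_by.
by have [k ->] := repr_proj_torus (- repr s); rewrite addrAC addKr proj_torus_int.
Qed.

Lemma torus_addN (s t : torus R p) :
  torus_add s (torus_add (proj_torus (- repr s)) t) = t.
Proof.
rewrite -[t in RHS]proj_torusK {2}/torus_add torus_add_given_by.
have [k ->] := repr_proj_torus (- repr s).
by rewrite addrA addrA subrr add0r addrC proj_torus_int.
Qed.

Lemma continuous_measurable_torus (phi : torus R p -> torus R p) : continuous phi ->
  measurable_fun [set: borel_torus R p] (phi : borel_torus R p -> borel_torus R p).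
Proof.
move=> /continuousP cphi.
apply: (@measurability _ _ (borel_torus R p) (borel_torus R p) setT phi
  (@open (torus R p))) => //.
move=> _ [U oU <-]; rewrite setTI; apply: sub_sigma_algebra; exact: cphi.
Qed.

Lemma measurable_periodic f : continuous f -> Zn_periodic f ->
  measurable_fun [set: borel_torus R p] (fun t : borel_torus R p => f (repr (t : torus R p))).
Proof.
move=> cf pf; apply: (measurability _ (RGenOpens.measurableE R)).
move=> _ [_ [a [b ->] <-]]; rewrite setTI; apply: sub_sigma_algebra.
have : continuous (fun t : torus R p => f (repr t)).
  apply/quotient_continuous; rewrite (_ : _ \o _ = f)//.
  by apply/funext => x; exact: repr_periodic.
by move=> /continuousP; apply; exact: interval_open.
Qed.

Variable mu : probability (borel_torus R p) R.

Lemma integrable_periodic f : continuous f -> Zn_periodic f ->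
  mu.-integrable [set: borel_torus R p] (EFin \o (fun t => f (repr (t : torus R p)))).
Proof.
move=> cf pf; apply: measurable_bounded_integrable => //.
- by have := @probability_setT _ _ R mu; move=> E; rewrite [X in (X < _)%E]E ltry.
- exact: measurable_periodic.
have [K fK] := periodic_bounded cf pf.
exists K; split; rewrite ?num_real// => x Kx t _ /=.
exact: le_trans (fK _) (ltW Kx).
Qed.

Definition mean f : R := \int[mu]_(t in [set: borel_torus R p]) f (repr (t : torus R p)).

Lemma meanD f g : continuous f -> Zn_periodic f -> continuous g -> Zn_periodic g ->
  mean (fun x => f x + g x) = mean f + mean g.
Proof. by move=> cf pf cg pg; apply: RintegralD => //; apply: integrable_periodic. Qed.

Lemma meanZ c f : continuous f -> Zn_periodic f -> mean (fun x => c * f x) = c * mean f.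
Proof. by move=> cf pf; apply: RintegralZl => //; apply: integrable_periodic. Qed.

Lemma mean_cst c : mean (fun=> c) = c.
Proof. by rewrite /mean Rintegral_cst//= probability_setT mulr1. Qed.

Lemma continuous_scale c f : continuous f -> continuous (fun x => c * f x).
Proof.
move=> cf x; apply: (@continuousM R _ (fun=> c) f); last exact: cf.
exact: cst_continuous.
Qed.

Lemma mean_sum (I : Type) (r : seq I) (c : I -> R) (f : I -> 'cV[R]_p -> R) :
  (forall i, continuous (f i)) -> (forall i, Zn_periodic (f i)) ->
  mean (fun x => \sum_(i <- r) c i * f i x) = \sum_(i <- r) c i * mean (f i).
Proof.
move=> cf pf; elim: r => [|i r IH].
  transitivity (mean (fun=> 0)); last by rewrite mean_cst big_nil.
  by congr (mean _); apply/funext => x; rewrite big_nil.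
rewrite big_cons -IH -meanZ// -meanD.
- by congr (mean _); apply/funext => x; rewrite big_cons.
- exact: continuous_scale.
- by move=> x k; rewrite pf.
- by apply: continuous_sum => j; exact: continuous_scale.
- by move=> x k; apply: eq_bigr => j _; rewrite pf.
Qed.

(** The translations of the torus are Borel isomorphisms, so that invariance of the
    measure of direct images is invariance of the push-forward measure. *)
Lemma mean_shift f (a : 'cV[R]_p) : is_haar mu -> continuous f -> Zn_periodic f ->
  mean (fun x => f (x + a)) = mean f.
Proof.
move=> hmu cf pf; pose s := proj_torus a.
pose phi : borel_torus R p -> borel_torus R p := torus_add s.
have mphi : measurable_fun setT phi.
  apply: continuous_measurable_torus; apply: given_by_continuous (torus_add_given_by s) _.
  by apply: smooth_continuous; apply: smooth_add; [exact: smooth_cst|exact: smooth_id].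
have inv A : measurable A -> mu (phi @^-1` A) = mu A.
  move=> mA; rewrite -(hmu (proj_torus (- repr s)) A mA); congr (mu _).
  apply/seteqP; split => [t At|_ [t At <-]]; last by rewrite /phi /= torus_addN.
  by exists (phi t) => //; exact: torus_add_opp.
have E t : f (repr (phi t)) = f (repr (t : torus R p) + a).
  rewrite /phi /torus_add (repr_periodic _ pf) /s.
  by have [k ->] := repr_proj_torus a; rewrite addrAC pf addrC.
rewrite /mean /Rintegral; congr fine.
under eq_integral do rewrite -E.
have := @integral_pushforward _ _ _ _ R phi mphi mu setT
  (fun t => (f (repr (t : torus R p)))%:E).
rewrite preimage_setT => <- //.
- by apply: eq_measure_integral => A mA _; exact: inv.
- by apply/measurable_EFinP; exact: measurable_periodic.
- rewrite [X in integrable _ _ X](_ : _ =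
    EFin \o (fun t => f (repr (t : torus R p) + a))); last first.
    by apply/funext => t; rewrite /= E.
  apply: (@integrable_periodic (fun x => f (x + a))); last by move=> x k; rewrite addrAC pf.
  move=> x; apply: (@continuous_comp _ _ _ (fun x : 'cV[R]_p => x + a) f); last exact: cf.
  by apply: smooth_continuous; apply: smooth_add; [exact: smooth_id|exact: smooth_cst].
Qed.

Lemma torus_mean_cohomologous q (alpha : 'cV[R]_p) (B : 'M[R]_q)
    (F u : 'cV[R]_p -> 'cV[R]_q) (b : 'cV[R]_q) :
  is_haar mu -> smooth u -> Zn_periodic u ->
  (forall x, F x = b + (u (x + alpha) - B *m u x)) ->
  torus_mean mu F = b + (torus_mean mu u - B *m torus_mean mu u).
Proof.
move=> hmu su pu H.
have cu i : continuous (fun x : 'cV[R]_p => u x i 0).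
  by apply: smooth_continuous; exact: smooth_coord.
have pui i : Zn_periodic (fun x : 'cV[R]_p => u x i 0) by move=> x k; rewrite pu.
apply/colP => i; rewrite !mxE.
transitivity (mean (fun x => b i 0 + (u (x + alpha) i 0 +
    (-1) * \sum_j B i j * u x j 0))).
  by apply: eq_Rintegral => t _; rewrite H !mxE mulN1r.
have cs : continuous (fun x : 'cV[R]_p => u (x + alpha) i 0).
  apply: smooth_continuous; apply: (@smooth_shift R _ p alpha (fun x => u x i 0 : R)).
  exact: smooth_coord.
have ps : Zn_periodic (fun x : 'cV[R]_p => u (x + alpha) i 0) by move=> x k; rewrite addrAC pu.
have cB : continuous (fun x => \sum_j B i j * u x j 0).
  by apply: continuous_sum => j; exact: continuous_scale.
have pB : Zn_periodic (fun x => \sum_j B i j * u x j 0).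
  by move=> x k; rewrite pu.
rewrite meanD ?mean_cst; last 4 first.
- by move=> x; exact: cst_continuous.
- by [].
- by apply: continuous_add => //; exact: continuous_scale.
- by move=> x k; rewrite ps pB.
rewrite meanD//; last 2 first.
- exact: continuous_scale.
- by move=> x k; rewrite pB.
rewrite meanZ// mean_sum// (mean_shift alpha hmu (cu i) (pui i)) mulN1r.
by congr (_ + (_ - _)); apply: eq_bigr => j _; rewrite mxE.
Qed.

End HaarMean.

(** * Orthogonal projection on the kernel of a transpose *)

Section OrthogonalProjection.
Variable R : realType.

Lemma dotvE n (x y : 'cV[R]_n) : dotv x y = (x^T *m y) 0 0.
Proof. by rewrite mxE; apply: eq_bigr => i _; rewrite mxE. Qed.

Lemma dotv_eq0 n (x : 'cV[R]_n) : dotv x x = 0 -> x = 0.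
Proof.
move=> /eqP; rewrite psumr_eq0 => [/allP x0|i _]; last by rewrite -expr2 sqr_ge0.
apply/colP => i; rewrite mxE; apply/eqP.
by have := x0 i (mem_index_enum i); rewrite mulf_eq0 orbb.
Qed.

Lemma dotv_range_kernel n (A : 'M[R]_n) (w k : 'cV[R]_n) :
  A^T *m k = 0 -> dotv (A *m w) k = 0.
Proof. by move=> k0; rewrite dotvE trmx_mul -mulmxA k0 mulmx0 mxE. Qed.

(** The kernel and the range meet trivially because the dot product is definite, and
    their dimensions add up to [n]. *)
Lemma range_kernel_decomposition n (A : 'M[R]_n) (x : 'cV[R]_n) :
  exists k w, A^T *m k = 0 /\ x = k + A *m w.
Proof.
have cap0 : (kermx A :&: A^T = 0)%MS.
  apply/eqP/rowV0P => v; rewrite sub_capmx => /andP[/sub_kermxP vA /submxP[w vE]].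
  apply: trmx_inj; rewrite trmx0; apply: dotv_eq0.
  by rewrite dotvE trmxK {1}vE -mulmxA -trmx_mul vA trmx0 mulmx0 mxE.
have full : row_full (kermx A + A^T)%MS.
  by rewrite /row_full (mxrank_disjoint_sum cap0) mxrank_ker mxrank_tr subnK ?rank_leq_row.
have /sub_addsmxP[[v w] /= E] := submx_full x^T full.
exists (v *m kermx A)^T, w^T; split.
  by rewrite -trmx_mul -mulmxA mulmx_ker mulmx0 trmx0.
by apply: trmx_inj; rewrite E linearD /= !trmx_mul !trmxK.
Qed.

(** [x - orth_proj _ x] is orthogonal to the kernel, so the kernel component in its
    decomposition is orthogonal to itself, hence zero. *)
Lemma orth_proj_range n (A : 'M[R]_n) (x : 'cV[R]_n) :
  exists w, x = orth_proj (kernel_set A^T) x + A *m w.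
Proof.
have [k [w [k0 E]]] := range_kernel_decomposition A x.
have P : [set y | kernel_set A^T y /\
    forall v, kernel_set A^T v -> dotv (x - y) v = 0] k.
  by split=> // v v0; rewrite E addrC addKr; exact: dotv_range_kernel.
rewrite /orth_proj; set y := get _.
have [_ y_orth] := getPex (ex_intro _ k P); rewrite -/y in y_orth.
have [k' [w' [k'0 E']]] := range_kernel_decomposition A (x - y).
have : dotv (x - y) k' = 0 by exact: y_orth.
rewrite {1}E' dotvE linearD /= mulmxDl mxE -!dotvE dotv_range_kernel// addr0.
move=> /dotv_eq0 k'00; exists w'.
by rewrite -[A *m w']add0r -k'00 -E' addrC subrK.
Qed.

End OrthogonalProjection.

(** * Minimality and eigenvalues *)

Section Minimality.
Variable R : realType.

(** The eigenvector of [A] for [a] is killed by [1 + a + ... + a^(m-1) = 0], so the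
    determinant of the integer matrix vanishes, and a singular matrix over an
    integral domain has a nonzero kernel vector over this same domain. *)
Lemma int_vector_annihilates n (A : 'M[int]_n) (m : nat) (a : R[i]) :
  complex_eigenvalue A a -> a ^+ m = 1 -> a != 1 ->
  exists2 v : 'rV[int]_n, v != 0 & v *m (\sum_(j < m) A ^+ j) = 0.
Proof.
move=> /eigenvalueP[w wA w0] am a1; apply/det0P.
have wS : w *m map_mx intr (\sum_(j < m) A ^+ j) = 0.
  have wj j : w *m map_mx intr (A ^+ j) = a ^+ j *: w.
    elim: j => [|j IH]; first by rewrite !expr0 map_mx1 mulmx1 scale1r.
    by rewrite exprSr map_mxM mulmxA IH -scalemxAl wA scalerA -exprSr.
  rewrite raddf_sum mulmx_sumr (eq_bigr (fun j : 'I_m => a ^+ j *: w)); last first.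
    by move=> j _; rewrite wj.
  rewrite -scaler_suml.
  have /eqP : (a - 1) * \sum_(j < m) a ^+ j = 0 by rewrite -subrX1 am subrr.
  by rewrite mulf_eq0 subr_eq0 (negPf a1) => /eqP ->; rewrite scale0r.
have : \det (map_mx intr (\sum_(j < m) A ^+ j) : 'M[R[i]]_n) == 0.
  by apply/det0P; exists w.
by rewrite det_map_mx /= intr_eq0.
Qed.

End Minimality.

Section PeriodicObservable.
Variable R : realType.

(** The values of [f] on the whole orbit are those at the first [m] points of it: a
    point [k] steps backward has the same value as the point [m * k] steps after it,
    which lies on the forward orbit. *)
Lemma not_dense_orbit (T : topologicalType) (phi : T -> T) (f : T -> R) (m : nat) (x : T) :
  (0 < m)%N -> continuous f -> (forall y, f (iter m phi y) = f y) ->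
  (forall s : seq R, exists y, f y \notin s) -> ~ dense (full_orbit phi x).
Proof.
move=> m0 cf fm f_inf; have per j y : f (iter (j * m) phi y) = f y.
  by elim: j => [//|j IH]; rewrite mulSn iterD fm.
pose s := [seq f (iter j phi x) | j <- iota 0 m].
have fs k : f (iter k phi x) \in s.
  rewrite (divn_eq k m) addnC iterD.
  have -> : f (iter (k %% m) phi (iter (k %/ m * m) phi x)) =
    f (iter (k %% m) phi x).
    by rewrite -iterD addnC iterD per.
  by apply: map_f; rewrite mem_iota /= ltn_mod.
have orbit_s y : full_orbit phi x y -> f y \in s.
  move=> [k [->|xE]]; first exact: fs.
  rewrite -(per k y) -(subnK (leq_pmulr k m0)) iterD -xE.
  exact: fs.
move=> /(_ (f @^-1` (~` [set` s])))[].
- have [y ys] := f_inf s; exists y => /= ys'; by rewrite ys' in ys.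
- move/continuousP: cf; apply; rewrite openC.
  apply: (proj1 accessible_finite_set_closed); last exact: finite_seq.
  exact: hausdorff_accessible (@Rhausdorff R).
- by move=> y [] /= ys /orbit_s.
Qed.

(** The reciprocals of the positive integers are infinitely many values of the cosine. *)
Lemma cos_avoids (s : seq R) : exists t, cos t \notin s.
Proof.
pose ys := [seq i.+1%:R^-1 : R | i <- iota 0 (size s).+1].
have uys : uniq ys.
  by rewrite map_inj_uniq ?iota_uniq// => i j /invr_inj /eqP; rewrite eqr_nat => /eqP[].
have /allPn[y yys ys'] : ~~ all (mem s) ys.
  apply/negP => /allP H; have := uniq_leq_size uys H.
  by rewrite size_map size_iota ltnn.
exists (acos y); rewrite acosK//.
move/mapP: yys => [i _ ->]; rewrite in_itv /=; apply/andP; split.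
  by apply: (@le_trans _ _ 0); rewrite ?invr_ge0// oppr_le0.
by rewrite invf_le1// ler1n.
Qed.

Variables p q : nat.
Implicit Types (B : 'M[int]_q) (C : 'M[int]_(q, p)) (z : 'cV[R]_(p + q)).

Lemma skew_lift_affine alpha B C (b : 'cV[R]_q) z :
  skew_lift alpha B C (fun=> b) z = intmx R (linear_part B C) *m z + col_mx alpha b.
Proof.
rewrite /skew_lift -[in RHS](vsubmxK z) /linear_part /intmx map_block_mx map_mx1 map_mx0.
by rewrite mul_block_col mul1mx mul0mx addr0 add_col_mx.
Qed.

Lemma iter_affine n (A : 'M[R]_n) (c z : 'cV[R]_n) m :
  iter m (fun y => A *m y + c) z = A ^+ m *m z + (\sum_(j < m) A ^+ j) *m c.
Proof.
elim: m => [|m IH]; first by rewrite expr0 mul1mx big_ord0 mul0mx addr0.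
rewrite iterS IH mulmxDr !mulmxA big_ord_recl expr0 mulmxDl mul1mx exprS.
rewrite (_ : \sum_(i < m) A ^+ (lift ord0 i) = A *m \sum_(i < m) A ^+ i).
  by rewrite -addrA [_ + c]addrC.
by rewrite mulmx_sumr; apply: eq_bigr => i _; rewrite exprS.
Qed.

(** Since [v (1 + ... + A^(m-1)) = 0], both [v A^m = v] and the contribution of the
    translation [c] to the [m]-th iterate vanishes. *)
Lemma annihilated_invariant n (A : 'M[int]_n) (v : 'rV[int]_n) m (c z : 'cV[R]_n) :
  v *m (\sum_(j < m) A ^+ j) = 0 ->
  intmx R v *m iter m (fun y => intmx R A *m y + c) z = intmx R v *m z.
Proof.
move=> vS; have vA : v *m A ^+ m = v.
  (* compute v (1 + A + ... + A^m) by splitting off its last and its first term *)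
  have : v *m (\sum_(j < m.+1) A ^+ j) = v *m (\sum_(j < m.+1) A ^+ j) by [].
  rewrite {1}big_ord_recr big_ord_recl /= !mulmxDr vS add0r expr0 mulmx1 => ->.
  rewrite (_ : \sum_(i < m) _ = (\sum_(j < m) A ^+ j) *m A); last first.
    by rewrite mulmx_suml; apply: eq_bigr => i _; rewrite exprSr.
  by rewrite mulmxA vS mul0mx addr0.
have E j : intmx R A ^+ j = intmx R (A ^+ j).
  elim: j => [|j IH]; first by rewrite !expr0 /intmx map_mx1.
  by rewrite !exprS IH -intmx_mul.
rewrite iter_affine mulmxDr !mulmxA E intmx_mul vA.
rewrite (eq_bigr (fun j : 'I_m => intmx R (A ^+ j))) => [|j _]; last exact: E.
rewrite /intmx -raddf_sum -map_mxM vS map_mx0 mul0mx addr0.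
by [].
Qed.

(** The observable is the cosine of [2 pi v h(z)], with [h] the conjugacy to the affine
    map: a function on the torus, as [v] is integral, invariant under the [m]-th iterate
    of [phi]. *)
Lemma minimal_eigenvalue alpha B C (F w : 'cV[R]_p -> 'cV[R]_q) b
    (phi : torus R (p + q) -> torus R (p + q)) (a : R[i]) :
  (forall x, F x = b + (w (x + alpha) - intmx R B *m w x)) ->
  smooth w -> Zn_periodic w -> given_by phi (skew_lift alpha B C F) ->
  quasi_unipotent R (linear_part B C) -> minimal phi ->
  complex_eigenvalue (linear_part B C) a -> a = 1.
Proof.
move=> H sw pw gphi qA mphi eA; have [//|a1] := eqVneq a 1; exfalso.
have [m m0 /unity_rootP am] := qA a eA.
have [v v0 vS] := int_vector_annihilates eA am a1.
set L := skew_lift alpha B C F in gphi.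
pose g z : R := cos (2 * pi * (intmx R v *m shear w z) 0 0).
have pg : Zn_periodic g.
  move=> z k; rewrite /g shear_int// mulmxDr intmx_mul [in LHS]mxE.
  by rewrite [intmx R (v *m k) 0 0]mxE mulrDr cosD2pi_int.
have cg : continuous g.
  have sv : smooth (fun z => (2 * pi) *: (intmx R v *m shear w z)).
    by apply: smooth_scale; apply: smooth_mulmx; exact: smooth_shear.
  have cv := smooth_continuous (smooth_coord 0 0 sv).
  rewrite (_ : g = fun z => cos (((2 * pi) *: (intmx R v *m shear w z)) 0 0)); last first.
    by apply/funext => z; rewrite /g [in RHS]mxE.
  move=> z; apply: (@continuous_comp _ _ _
    (fun z => ((2 * pi) *: (intmx R v *m shear w z)) 0 0 : R) cos); first exact: cv.
  exact: continuous_cos.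
have itL j z : shear w (iter j L z) = iter j (skew_lift alpha B C (fun=> b)) (shear w z).
  by elim: j => //= j <-; rewrite (shear_skew_lift _ _ H).
have gL z : g (iter m L z) = g z.
  rewrite /g itL (_ : skew_lift _ _ _ _ =
    fun z => intmx R (linear_part B C) *m z + col_mx alpha b).
    by rewrite annihilated_invariant.
  by apply/funext => y; exact: skew_lift_affine.
have itphi j z : iter j phi (proj_torus z) = proj_torus (iter j L z).
  by elim: j => //= j ->.
pose G t := g (repr (t : torus R (p + q))).
have Gproj z : G (proj_torus z) = g z by exact: repr_periodic.
apply: (@not_dense_orbit _ phi G m point m0); last exact: mphi.
- apply/quotient_continuous; rewrite (_ : _ \o _ = g)//.
  by apply/funext => z; exact: Gproj.
- by move=> t; rewrite -(proj_torusK t) itphi !Gproj gL.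
move=> s; have [t ts] := cos_avoids s.
have [i vi] : exists i, v 0 i != 0.
  by apply/rV0Pn.
pose Z : 'cV[R]_(p + q) := (t / (2 * pi) / (v 0 i)%:~R) *: delta_mx i 0.
exists (proj_torus (shear (fun x => - w x) Z)); rewrite Gproj /g.
have -> : shear w (shear (fun x => - w x) Z) = Z.
  have := shearK (fun x => - w x) Z.
  by rewrite (_ : (fun x => - - w x) = w)//; apply/funext => x; rewrite opprK.
have vi' : (v 0 i)%:~R != 0 :> R by rewrite intr_eq0.
have pi0 : pi != 0 :> R by rewrite lt0r_neq0 ?pi_gt0.
have -> : 2 * pi * (intmx R v *m Z) 0 0 = t.
  by rewrite /Z -scalemxAr -colE !mxE divfK// mulrC divfK// mulf_neq0.
exact: ts.
Qed.

End PeriodicObservable.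

Theorem theorem3 (R : realType) (n p : nat)
    (alpha : 'cV[R]_p) (B : 'M[int]_(n - p)) (C : 'M[int]_(n - p, p))
    (F : 'cV[R]_p -> 'cV[R]_(n - p))
    (phi : torus R (p + (n - p)) -> torus R (p + (n - p))) :
  (1 <= p)%N -> (p < n)%N ->
  B \in unitmx ->
  smooth F -> Zn_periodic F ->
  torus_diffeo phi ->
  given_by phi (skew_lift alpha B C F) ->
  quasi_unipotent R (linear_part B C) ->
  diophantine alpha ->
  (forall mu : probability (borel_torus R p) R, is_haar mu ->
     let beta := torus_mean mu F in
     let beta1 := orth_proj (kernel_set (1%:M - intmx R B)^T) beta in
     exists phi0 : torus R (p + (n - p)) -> torus R (p + (n - p)),
       given_by phi0 (skew_lift alpha B C (fun=> beta1)) /\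
       smoothly_conjugate phi phi0) /\
  (minimal phi ->
     forall a : R[i], complex_eigenvalue (linear_part B C) a <-> a = 1).
Proof.
move=> p0 pn _ sF pF _ gphi qA da.
have qB : quasi_unipotent R B.
  move=> a /(eigenvalue_linear_part C)[->|/qA //]; exists 1; first by [].
  by rewrite /root_of_unity rootE !hornerE subrr.
have [m [N [m0 BN]]] := quasi_unipotent_nilpotent qB.
have [b [u [su pu H]]] := twisted_cohomological_equation m0 BN da sF pF.
split=> [mu hmu beta beta1|mphi a]; last first.
  split=> [|->]; first exact: minimal_eigenvalue H su pu gphi qA mphi.
  exact: one_eigenvalue_linear_part.
have [w0 w0E] := orth_proj_range (1%:M - intmx R B) beta.
rewrite -/beta1 in w0E.
(* b = beta1 + (1 - B) (w0 - mean u): absorb the second term into the solution *)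
pose w x := u x + (w0 - torus_mean mu u).
have betaE := torus_mean_cohomologous hmu su pu H; rewrite -/beta w0E in betaE.
have wE x : F x = beta1 + (w (x + alpha) - intmx R B *m w x).
  rewrite H /w mulmxDr mulmxBr.
  move: betaE; rewrite mulmxBl mul1mx => /eqP; rewrite -subr_eq => /eqP <-.
  move: (intmx R B *m w0) (intmx R B *m torus_mean mu u) (intmx R B *m u x) => *.
  by apply/colP => i; rewrite !mxE; ring.
apply: skew_product_conjugate wE _ _ gphi.
- by apply: smooth_add => //; exact: smooth_cst.
- by move=> x k; rewrite /w pu.
Qed.
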